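(* Suppose that the KKT system (K) has a nonempty solution set and that the self-adjoint operators $\mathcal D_i:\mathbb Y_i\to\mathbb Y_i$ satisfy $$\tfrac12\widehat\Sigma^f_{ii}+\sigma\mathcal F_i\mathcal F_i^*+\mathcal D_i\succ0\ (i=1,\dots,s)\quad\text{and}\quad\mathcal D:=\operatorname{Diag}(\mathcal D_1,\dots,\mathcal D_s)\succeq-\tfrac12\widehat\Sigma^f .$$ Let $\{(x^k,y^k,z^k)\}$ be a sequence generated by Algorithm sGS-iPADMM (with $\tau\in(0,2)$). Then: (a) the sequence $\{(y^k,\Pi_{\operatorname{Range}(\mathcal G)}(z^k))\}$ converges to a solution of problem (P), and the sequence $\{x^k\}$ converges to a solution of the dual of (P); (b) any accumulation point of $\{(y^k,z^k)\}$ is a solution of problem (P); (c) the sequence $\{p(y_1^k)+f(y^k)-\langle b,z^k\rangle\}$ of objective values converges to the optimal value of problem (P), and $\lim_{k\to\infty}(\mathcal F^*y^k+\mathcal G^*z^k-c)=0$; (d) with $\mathbf K$ the solution set of the KKT system (K), $\lim_{k\to\infty}\operatorname{dist}\big((x^k,y^k,z^k),\mathbf K\big)=0$; (e) if the linear operator $\mathcal G$ is surjective, the whole sequence $\{(x^k,y^k,z^k)\}$ converges to a solution of the KKT system (K).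
   Context: $\mathbb X$, $\mathbb Y=\mathbb Y_1\times\cdots\times\mathbb Y_s$, $\mathbb Z$ are finite-dimensional real Hilbert spaces. For self-adjoint $\mathcal O$, $\|\nu\|_{\mathcal O}^2:=\langle\nu,\mathcal O\nu\rangle$ (also if $\mathcal O$ is indefinite). $\Pi_H$ is the metric projection onto $H$, $\operatorname{dist}$ the distance to a set. Problem (P): $\min_{y\in\mathbb Y,z\in\mathbb Z}\{p(y_1)+f(y)-\langle b,z\rangle\mid\mathcal F^*y+\mathcal G^*z=c\}$, with $p:\mathbb Y_1\to(-\infty,+\infty]$ closed proper convex, $f:\mathbb Y\to\mathbb R$ convex, continuously differentiable with Lipschitz gradient, $\mathcal F:\mathbb X\to\mathbb Y$, $\mathcal G:\mathbb X\to\mathbb Z$ linear, $b\in\mathbb Z$, $c\in\mathbb X$. Write $\mathcal Fx=(\mathcal F_1x;\dots;\mathcal F_sx)$ with $\mathcal F_i:\mathbb X\to\mathbb Y_i$. The dual of (P) is the Lagrangian dual: maximize over $x\in\mathbb X$ the function $\inf_{y,z}\{p(y_1)+f(y)-\langle b,z\rangle+\langle x,\mathcal F^*y+\mathcal G^*z-c\rangle\}$. KKT system (K): $0\in(\partial p(y_1);0)+\nabla f(y)+\mathcal Fx$, $\ \mathcal Gx-b=0$, $\ \mathcal F^*y+\mathcal G^*z=c$, for $(x,y,z)\in\mathbb X\times\mathbb Y\times\mathbb Z$. $\widehat\Sigma^f:\mathbb Y\to\mathbb Y$ is self-adjoint positive semidefinite with blocks $\widehat\Sigma^f_{ij}:\mathbb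 Y_j\to\mathbb Y_i$, such that $f(y)\le\widehat f(y,y'):=f(y')+\langle\nabla f(y'),y-y'\rangle+\tfrac12\|y-y'\|^2_{\widehat\Sigma^f}$ for all $y,y'$. For $\sigma>0$, $$\mathcal L_\sigma(y,z;(x,y')):=p(y_1)+\widehat f(y,y')-\langle b,z\rangle+\langle\mathcal F^*y+\mathcal G^*z-c,x\rangle+\tfrac\sigma2\|\mathcal F^*y+\mathcal G^*z-c\|^2 .$$ Algorithm sGS-iPADMM: $\{\tilde\varepsilon_k\}$ is a summable nonnegative sequence, $\tau\in(0,2)$, $(x^0,y^0,z^0)\in\mathbb X\times\mathbb Y\times\mathbb Z$ with $y_1^0\in\operatorname{dom}p$, $\mathcal D_i:\mathbb Y_i\to\mathbb Y_i$ self-adjoint linear. Write $y_{<i}=(y_1;\dots;y_{i-1})$, $y_{>i}=(y_{i+1};\dots;y_s)$. For $k=0,1,\dots$: Step 1. For $i=s,\dots,2$ compute $y_i^{k+1/2}\approx\operatorname{argmin}_{y_i}\{\mathcal L_\sigma((y^k_{<i};y_i;y^{k+1/2}_{>i}),z^k;(x^k,y^k))+\tfrac12\|y_i-y_i^k\|^2_{\mathcal D_i}\}$ such that there is $\tilde\delta_i^k$ with $\|\tilde\delta_i^k\|\le\tilde\varepsilon_k$ and $\tilde\delta_i^k\in\partial_{y_i}\mathcal L_\sigma((y^k_{<i};y_i^{k+1/2};y^{k+1/2}_{>i}),z^k;(x^k,y^k))+\mathcal D_i(y_i^{k+1/2}-y_i^k)$. Step 2. For $i=1,\dots,s$ compute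 $y_i^{k+1}\approx\operatorname{argmin}_{y_i}\{\mathcal L_\sigma((y^{k+1}_{<i};y_i;y^{k+1/2}_{>i}),z^k;(x^k,y^k))+\tfrac12\|y_i-y_i^k\|^2_{\mathcal D_i}\}$ such that there is $\delta_i^k$ with $\|\delta_i^k\|\le\tilde\varepsilon_k$ and $\delta_i^k\in\partial_{y_i}\mathcal L_\sigma((y^{k+1}_{<i};y_i^{k+1};y^{k+1/2}_{>i}),z^k;(x^k,y^k))+\mathcal D_i(y_i^{k+1}-y_i^k)$. Step 3. Compute $z^{k+1}\approx\operatorname{argmin}_z\mathcal L_\sigma(y^{k+1},z;(x^k,y^k))$ such that $\|\gamma^k\|\le\tilde\varepsilon_k$, where $\gamma^k:=\nabla_z\mathcal L_\sigma(y^{k+1},z^{k+1};(x^k,y^k))=\mathcal Gx^k-b+\sigma\mathcal G(\mathcal F^*y^{k+1}+\mathcal G^*z^{k+1}-c)$. Step 4. $x^{k+1}:=x^k+\tau\sigma(\mathcal F^*y^{k+1}+\mathcal G^*z^{k+1}-c)$. *)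

(* Defs.v *)
From HB Require Import structures.
From mathcomp Require Import all_boot all_order all_algebra.
From mathcomp Require Import all_classical all_reals all_analysis.
From mathcomp Require Import ring lra.

Set Implicit Arguments.
Unset Strict Implicit.
Unset Printing Implicit Defensive.

Import Order.TTheory GRing.Theory Num.Theory.
Import numFieldNormedType.Exports.

Local Open Scope classical_set_scope.
Local Open Scope ring_scope.

(** * Finite-dimensional real Hilbert spaces *)

(* Finite dimension comes from [Vector]; the topology is that of the norm, and
   [dotxx] says that the norm is the Hilbert norm. *)
HB.mixin Record isHilbert (R : realType) V
    & Vector R V & NormedModule R V := {
  dot : V -> V -> R;
  dotC : forall u v, dot u v = dot v u;
  dot_linearl : forall v (a : R) u w,
    dot (a *: u + w) v = a * dot u v + dot w v;
  dotxx : forall u, dot u u = `|u| ^+ 2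
}.

#[short(type="hilbertType")]
HB.structure Definition Hilbert (R : realType) :=
  { V of Vector R V & NormedModule R V & isHilbert R V }.

HB.factory Record Vector_isHilbert (R : realType) V & Vector R V := {
  dot : V -> V -> R;
  dotC : forall u v, dot u v = dot v u;
  dot_linearl : forall v (a : R) u w,
    dot (a *: u + w) v = a * dot u v + dot w v;
  dot_ge0 : forall u, 0 <= dot u u;
  dot_eq0 : forall u, dot u u = 0 -> u = 0
}.

HB.builders Context R V & Vector_isHilbert R V.

Let dotDl u w v : dot (u + w) v = dot u v + dot w v.
Proof. by have := dot_linearl v 1 u w; rewrite scale1r mul1r. Qed.

Let dot0l v : dot 0 v = 0.
Proof. by have := dotDl 0 0 v; rewrite addr0; lra. Qed.

Let dotZl a u v : dot (a *: u) v = a * dot u v.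
Proof. by have := dot_linearl v a u 0; rewrite addr0 dot0l addr0. Qed.

Let dotDr v u w : dot v (u + w) = dot v u + dot v w.
Proof. by rewrite dotC dotDl !(dotC v). Qed.

Let dotZr a v u : dot v (a *: u) = a * dot v u.
Proof. by rewrite dotC dotZl (dotC v). Qed.

Let hnorm (u : V) : R := Num.sqrt (dot u u).

Let sqr_hnorm u : hnorm u ^+ 2 = dot u u.
Proof. by rewrite sqr_sqrtr ?dot_ge0. Qed.

Let hnorm_ge0 u : 0 <= hnorm u. Proof. exact: sqrtr_ge0. Qed.

Let hnormZ (a : R) u : hnorm (a *: u) = `|a| * hnorm u.
Proof.
by rewrite /hnorm dotZl dotZr mulrA -expr2 sqrtrM ?sqr_ge0// sqrtr_sqr.
Qed.

Let hnorm_eq0 u : hnorm u = 0 -> u = 0.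
Proof.
by move=> u0; apply: dot_eq0; rewrite -sqr_hnorm u0 expr0n.
Qed.

Let cauchy_schwarz u v : dot u v <= hnorm u * hnorm v.
Proof.
have [v0|v_neq0] := eqVneq (hnorm v) 0.
  by rewrite v0 mulr0 (hnorm_eq0 v0) dotC dot0l.
have v_gt0 : 0 < hnorm v by rewrite lt_def v_neq0 hnorm_ge0.
have [u0|u_neq0] := eqVneq (hnorm u) 0.
  by rewrite u0 mul0r (hnorm_eq0 u0) dot0l.
have u_gt0 : 0 < hnorm u by rewrite lt_def u_neq0 hnorm_ge0.
have := dot_ge0 (hnorm v *: u + (- hnorm u) *: v).
rewrite dotDl !dotDr !dotZl !dotZr (dotC v u) -!sqr_hnorm.
set a := hnorm u in u_gt0 *; set b := hnorm v in v_gt0 *; set d := dot u v.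
have -> : b * (b * a ^+ 2) + b * (- a * d) + (- a * (b * d) + - a * (- a * b ^+ 2))
  = (2 * (a * b)) * (a * b - d).
  by ring.
by rewrite pmulr_rge0 ?subr_ge0// !mulr_gt0.
Qed.

Let hnormD u v : hnorm (u + v) <= hnorm u + hnorm v.
Proof.
rewrite -(@ler_pXn2r _ 2)// ?nnegrE ?addr_ge0//.
rewrite sqrrD !sqr_hnorm dotDl !dotDr (dotC v u).
by have := cauchy_schwarz u v; lra.
Qed.

HB.instance Definition _ := Lmodule_isNormed.Build R V hnormD hnormZ hnorm_eq0.

Let dotxx u : dot u u = `|u| ^+ 2.
Proof. by rewrite -sqr_hnorm. Qed.

HB.instance Definition _ := isHilbert.Build R V dotC dot_linearl dotxx.

HB.end.

(** * Products of Hilbert spaces *)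

(* Plain dependent functions, renamed so that they carry the Hilbert product
   structure. *)
Definition hprod (R : realType) n (Y : 'I_n -> hilbertType R) : Type :=
  forall i, Y i.

Section hprod.
Import VectorInternalTheory.
Context {R : realType} {n : nat} (Y : 'I_n -> hilbertType R).
Local Notation V := (hprod Y).

HB.instance Definition _ := gen_eqMixin V.
HB.instance Definition _ := gen_choiceMixin V.

Let zero : V := fun=> 0.
Let opp (u : V) : V := fun i => - u i.
Let add (u v : V) : V := fun i => u i + v i.
Let scale (a : R) (u : V) : V := fun i => a *: u i.

Let hprodP (u v : V) : (forall i, u i = v i) -> u = v.
Proof. exact: functional_extensionality_dep. Qed.

Let addA : associative add.
Proof. by move=> u v w; apply: hprodP => i; apply: addrA. Qed.
Let addC : commutative add.
Proof. by move=> u v; apply: hprodP => i; apply: addrC. Qed.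
Let add0 : left_id zero add.
Proof. by move=> u; apply: hprodP => i; apply: add0r. Qed.
Let addN : left_inverse zero opp add.
Proof. by move=> u; apply: hprodP => i; apply: addNr. Qed.

HB.instance Definition _ := GRing.isZmodule.Build V addA addC add0 addN.

Let scaleA a b (u : V) : scale a (scale b u) = scale (a * b) u.
Proof. by apply: hprodP => i; apply: scalerA. Qed.
Let scale1 : left_id 1 scale.
Proof. by move=> u; apply: hprodP => i; apply: scale1r. Qed.
Let scaleDr : right_distributive scale +%R.
Proof. by move=> a u v; apply: hprodP => i; apply: scalerDr. Qed.
Let scaleDl (u : V) : {morph scale^~ u : a b / a + b}.
Proof. by move=> a b; apply: hprodP => i; apply: scalerDl. Qed.

HB.instance Definition _ :=
  GRing.Zmodule_isLmodule.Build R V scaleA scale1 scaleDr scaleDl.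

Lemma hprod0E i : (0 : V) i = 0. Proof. by []. Qed.
Lemma hprodNE (u : V) i : (- u) i = - u i. Proof. by []. Qed.
Lemma hprodDE (u v : V) i : (u + v) i = u i + v i. Proof. by []. Qed.
Lemma hprodBE (u v : V) i : (u - v) i = u i - v i. Proof. by []. Qed.
Lemma hprodZE a (u : V) i : (a *: u) i = a *: u i. Proof. by []. Qed.

Let hprod_finDim : Vector.axiom (\sum_i dim (Y i)) V.
Proof.
exists (fun u => \mxrow_i v2r (u i)).
  move=> a u v; apply/mxrowP => j; rewrite submxrowD !mxrowK.
  transitivity (a *: v2r (u j) +
                v2r (v j)).
    exact: linearP.
  congr (_ + _); apply/matrixP => x y.
  by rewrite -[in LHS](mxrowK (fun i => v2r (u i))) !mxE.
exists (fun A => (fun i => r2v (submxrow A i)) : V) => u.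
  by apply: hprodP => i; rewrite mxrowK v2rK.
rewrite -[RHS]submxrowK; apply: eq_mxrow => i.
by rewrite r2vK.
Qed.

HB.instance Definition _ := Lmodule_hasFinDim.Build R V hprod_finDim.

Let hdot (u v : V) : R := \sum_i dot (u i) (v i).

Let hdotC u v : hdot u v = hdot v u.
Proof. by apply: eq_bigr => i _; apply: dotC. Qed.
Let hdot_linearl v (a : R) u w : hdot (a *: u + w) v = a * hdot u v + hdot w v.
Proof.
rewrite /hdot mulr_sumr -big_split; apply: eq_bigr => i _.
exact: dot_linearl.
Qed.
Let hdot_ge0 u : 0 <= hdot u u.
Proof. by apply: sumr_ge0 => i _; rewrite dotxx sqr_ge0. Qed.
Let hdot_eq0 u : hdot u u = 0 -> u = 0.
Proof.
have ge0 i : true -> 0 <= dot (u i) (u i) by rewrite dotxx sqr_ge0.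
move=> /(psumr_eq0P ge0) u0; apply: hprodP => i.
by apply/eqP; rewrite -normr_eq0 -sqrf_eq0 -dotxx u0.
Qed.

HB.instance Definition _ :=
  Vector_isHilbert.Build R V hdotC hdot_linearl hdot_ge0 hdot_eq0.

Lemma hprod_dotE (u v : V) : dot u v = \sum_i dot (u i) (v i).
Proof. by []. Qed.

End hprod.

(** * Operators and convex functions *)

Section operators.
Context {R : realType}.
Implicit Types V W : hilbertType R.

(* The vector representing a linear form; see [rieszE]. *)
Definition riesz V (phi : V -> R) : V :=
  xget 0 [set v | forall u, phi u = dot v u].

Let dotl V (u : V) : linear ((@dot R V)^~ u : V -> R^o).
Proof. by move=> a v w; exact: dot_linearl. Qed.

Let dot_linear V (v : V) : linear (dot v : V -> R^o).
Proof. by move=> a u w; rewrite -!(dotC _ v); exact: dot_linearl. Qed.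

Lemma rieszE V (phi : {linear V -> R^o}) (u : V) : phi u = dot (riesz phi) u.
Proof.
suff [v vP] : exists v, forall u, phi u = dot v u.
  exact: (xgetI 0 (vP : [set v | forall u, phi u = dot v u] v)).
pose b := vbasis {:V}.
have bP w : w = \sum_i coord b i w *: b`_i.
  by apply: coord_vbasis; rewrite memvf.
pose T (w : V) : 'rV[R]_(\dim {:V}) := \row_i dot w b`_i.
have Tlin : linear T.
  by move=> a v w; apply/rowP => i; rewrite !mxE dot_linearl.
pose TL := GRing.isLinear.Build _ _ _ _ T Tlin.
pose Tm : {linear V -> 'rV[R]_(\dim {:V})} := HB.pack T TL.
have sumE (psi : {linear V -> R^o}) w : psi w = \sum_i coord b i w * psi b`_i.
  by rewrite {1}(bP w) linear_sum; apply: eq_bigr => i _; rewrite linearZ.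
pose dl v := GRing.isLinear.Build _ _ _ _ (dot v : V -> R^o) (dot_linear v).
pose dm v : {linear V -> R^o} := HB.pack (dot v : V -> R^o) (dl v).
have Tker : lker (linfun Tm) == 0%VS.
  apply/lker0P => v w; rewrite !lfunE /= => /rowP Tvw.
  apply/eqP; rewrite -subr_eq0 -normr_eq0 -sqrf_eq0 -dotxx.
  have /= -> := sumE (dm (v - w)) (v - w); rewrite big1// => i _.
  have := Tvw i; rewrite !mxE => e.
  have -> : dot (v - w) b`_i = 0.
    by rewrite addrC -scaleN1r dot_linearl e mulN1r addNr.
  by rewrite mulr0.
have Timg : limg (linfun Tm) = fullv.
  apply/eqP; rewrite eqEdim subvf /= limg_dim_eq ?(eqP Tker) ?capv0//.
  by rewrite !dimvf /dim /= mul1n.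
have /memv_imgP [v _ vE] : (\row_i phi b`_i) \in limg (linfun Tm).
  by rewrite Timg memvf.
exists v => w; rewrite (sumE phi); have /= -> := sumE (dm v) w; apply: eq_bigr => i _.
by congr (_ * _); move: vE; rewrite lfunE => /rowP /(_ i); rewrite !mxE.
Qed.

Definition adj V W (A : V -> W) (w : W) : V := riesz (fun v => dot w (A v)).

Definition grad V (f : V -> R) (v : V) : V := riesz ('d f v).

Lemma adjE V W (A : {linear V -> W}) v w : dot (adj A w) v = dot w (A v).
Proof.
have L : linear (fun v => dot w (A v) : R^o).
  by move=> a u u'; rewrite linearP dot_linear.
pose LL := GRing.isLinear.Build _ _ _ _ (fun v => dot w (A v) : R^o) L.
pose Lm : {linear V -> R^o} := HB.pack (fun v => dot w (A v) : R^o) LL.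
by rewrite /adj -(rieszE Lm).
Qed.

Lemma gradE V (f : V -> R) (v u : V) : 'd f v u = dot (grad f v) u.
Proof. exact: rieszE. Qed.

Definition self_adjoint V (A : V -> V) := forall u v, dot u (A v) = dot (A u) v.

Definition pos_semidef V (A : V -> V) := forall u, 0 <= dot u (A u).

Definition pos_def V (A : V -> V) := forall u, u != 0 -> 0 < dot u (A u).

Definition metric_proj V (H : set V) (v : V) : V :=
  xget 0 [set w | H w /\ forall u, H u -> `|v - w| <= `|v - u|].

End operators.

Section convex_analysis.
Context {R : realType} (V : hilbertType R).
Local Open Scope ereal_scope.
Implicit Types phi : V -> \bar R.

Definition proper_function phi :=
  (forall v, phi v != -oo) /\ exists v, phi v != +oo.

(* The library's [convex_function] is for finite-valued functions only. *)
Definition econvex_function phi := forall (u v : V) (t : R), (0 < t < 1)%R ->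
  phi (t *: u + (1 - t) *: v)%R <= t%:E * phi u + (1 - t)%:E * phi v.

Definition edom phi : set V := [set v | phi v < +oo].

Definition subdiff phi (v : V) : set V :=
  [set g | forall u, phi v + (dot g (u - v)%R)%:E <= phi u].

End convex_analysis.

(** * The convex program and its optimality conditions *)

(* The index [ord0] is the block carrying the nonsmooth function [p], so that
   a product over ['I_n.+1] has at least that block. *)
Section problem.
Context {R : realType} {X Z : hilbertType R} {n : nat}.
Context {Y : 'I_n.+1 -> hilbertType R}.
Context (p : Y ord0 -> \bar R) (f : hprod Y -> R).
Context (F : {linear X -> hprod Y}) (G : {linear X -> Z}) (b : Z) (c : X).

Definition residual (y : hprod Y) (z : Z) : X := adj F y + adj G z - c.

Definition objective (y : hprod Y) (z : Z) : \bar R :=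
  (p (y ord0) + (f y - dot b z)%:E)%E.

Definition feasible : set (hprod Y * Z) := [set w | residual w.1 w.2 = 0].

Definition optimal_value : \bar R :=
  ereal_inf [set objective w.1 w.2 | w in feasible].

Definition primal_solution (y : hprod Y) (z : Z) : Prop :=
  [/\ feasible (y, z), objective y z \is a fin_num &
      forall w, feasible w -> (objective y z <= objective w.1 w.2)%E].

Definition dual_function (x : X) : \bar R :=
  ereal_inf [set (objective w.1 w.2 + (dot x (residual w.1 w.2))%:E)%E
            | w in [set: hprod Y * Z]].

Definition dual_solution (x : X) : Prop :=
  dual_function x \is a fin_num /\
  forall x', (dual_function x' <= dual_function x)%E.

(* The vector (u; 0; ...; 0), with [u] in position [i]. *)
Definition embed (i : 'I_n.+1) (u : Y i) : hprod Y :=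
  @dfwith _ (fun j => Y j : Type) (0 : hprod Y) i u.

Definition KKT (x : X) (y : hprod Y) (z : Z) : Prop :=
  [/\ exists2 g, subdiff p (y ord0) g & embed g + grad f y + F x = 0,
      G x - b = 0 &
      adj F y + adj G z = c].

Definition KKT_set : set (X * hprod Y * Z) := [set w | KKT w.1.1 w.1.2 w.2].

(* The product norm of the library is a maximum norm; this is the distance of
   the Hilbert space X * Y * Z. *)
Definition pdist (w w' : X * hprod Y * Z) : R :=
  Num.sqrt (`|w.1.1 - w'.1.1| ^+ 2 + `|w.1.2 - w'.1.2| ^+ 2
            + `|w.2 - w'.2| ^+ 2).

Definition dist_to (w : X * hprod Y * Z) (K : set (X * hprod Y * Z)) : R :=
  inf [set pdist w w' | w' in K].

(** * The algorithm *)

Definition op_comp (i : 'I_n.+1) (A : X -> hprod Y) (x : X) : Y i := A x i.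

Definition block (Sigma : hprod Y -> hprod Y) (i j : 'I_n.+1) (u : Y j) : Y i :=
  Sigma (embed u) i.

Definition Diag (D : forall i, Y i -> Y i) (y : hprod Y) : hprod Y :=
  fun i => D i (y i).

(* The vector (u_{<i}; v; w_{>i}). *)
Definition glue (u : hprod Y) (i : 'I_n.+1) (v : Y i) (w : hprod Y) : hprod Y :=
  @dfwith _ (fun j => Y j : Type) (fun j => if (j < i)%N then u j else w j) i v.

Definition fhat (Sigma : hprod Y -> hprod Y) (y y' : hprod Y) : R :=
  f y' + dot (grad f y') (y - y') + 2^-1 * dot (y - y') (Sigma (y - y')).

Definition aug_lagrangian (Sigma : hprod Y -> hprod Y) (sigma : R)
    (y : hprod Y) (z : Z) (x : X) (y' : hprod Y) : \bar R :=
  (p (y ord0) + (fhat Sigma y y' - dot b z + dot (residual y z) x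
                 + sigma / 2 * `|residual y z| ^+ 2)%:E)%E.

(* [u] minimizes [phi + 1/2 |. - u0|^2_D] up to an error [delta] in the
   optimality condition. *)
Definition inexact_argmin (V : hilbertType R) (phi : V -> \bar R) (D : V -> V)
    (u0 : V) (eps : R) (u : V) : Prop :=
  exists2 delta, `|delta| <= eps &
    exists2 g, subdiff phi u g & delta = g + D (u - u0).

Definition generated_by_sGS_iPADMM (Sigma : hprod Y -> hprod Y)
    (D : forall i, Y i -> Y i) (sigma tau : R) (eps : nat -> R)
    (x : nat -> X) (y : nat -> hprod Y) (z : nat -> Z) : Prop :=
  edom p (y 0%N ord0) /\
  (* [yh k] is y^{k+1/2}; its component [ord0] is never used *)
  exists yh : nat -> hprod Y, forall k,
  let L y' z' := aug_lagrangian Sigma sigma y' z' (x k) (y k) in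
  (* the gradient of [z' |-> aug_lagrangian Sigma sigma (y k.+1) z' (x k) (y k)]
     at [z k.+1] *)
  let gamma := G (x k) - b + sigma *: G (residual (y k.+1) (z k.+1)) in
  [/\ forall i : 'I_n.+1, (0 < i)%N ->
        inexact_argmin (fun u => L (glue (y k) u (yh k)) (z k))
          (D i) (y k i) (eps k) (yh k i),
      forall i : 'I_n.+1,
        inexact_argmin (fun u => L (glue (y k.+1) u (yh k)) (z k))
          (D i) (y k i) (eps k) (y k.+1 i),
      `|gamma| <= eps k &
      x k.+1 = x k + (tau * sigma) *: residual (y k.+1) (z k.+1)].

End problem.

(* Main.v *)
Require Import Defs.
From HB Require Import structures.
From mathcomp Require Import all_boot all_order all_algebra.
From mathcomp Require Import all_classical all_reals all_analysis.
From mathcomp Require Import ring lra.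

Set Implicit Arguments.
Unset Strict Implicit.
Unset Printing Implicit Defensive.

Import Order.TTheory GRing.Theory Num.Theory.
Import numFieldNormedType.Exports.

Local Open Scope classical_set_scope.
Local Open Scope ring_scope.

(** Write r for the residual adj F y + adj G z - c. The z-step and the
    multiplier step together multiply G x - b by 1 - tau, up to the tolerance
    of the z-step. As |1 - tau| < 1, the sequence G x - b is summable, and so
    is G r ([dual_residual_summable], [range_residual_summable]). Hence the
    component of the iteration in the range of adj G is exact up to summable
    errors, and it can be eliminated: with K the Moore-Penrose inverse of G and
    K G the orthogonal projection on that range ([moore_penrose]), there
    remains a problem in y alone, with constraint (I - K G)(adj F y - c) = 0
    and multiplier (I - K G) x ([KKT_inclusion], [inclusion_KKT]).

    For fixed z, the sweep minimizes block by block a convex function plus a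
    quadratic with Hessian M = Sigma + D + sigma F (adj F), first backward and
    then forward. The backward steps can be solved for in terms of the forward
    ones, and this turns the two passes into one proximal step with the
    additional operator B = U (Md)^-1 (adj U), where Md and U are the diagonal
    and strictly upper parts of M; the inexactness stays of the order of the
    tolerance ([sGS_sweep], [sweep_inclusion]). Eliminating z adds to the
    proximal term the part sigma F K G (adj F) of sigma F (adj F) that the
    reduced constraint does not see. So y and (I - K G) x follow an inexact
    proximal augmented Lagrangian method whose proximal operator is
    T = D + B + sigma F K G (adj F) ([reduced_step], [iterates_inclusion]).

    This T may be indefinite; only T + Sigma / 2 is positive semidefinite. The
    compensation comes from the linearization of f: the gradient of f is
    cocoercive in the seminorm of Sigma, so evaluating it at the previous
    iterate costs a quarter, not a half, of the squared length of the step
    ([gradient_quarter]). A Lyapunov function of the distance to any solution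
    then decreases up to a summable error ([lyapunov_decrease]); it is coercive
    because T + Sigma / 2 + sigma A (adj A) is positive definite, A being F on
    the kernel of G ([T_ker_pos], which rests on [sGS_kernel]). Boundedness,
    vanishing steps and a limit along a subsequence follow, and the Lyapunov
    function at that limit gives convergence of the whole sequence
    ([proximal_ALM_converges]).

    The variable z enters the optimality conditions only through adj G z, which
    converges, and its projection on the range of G is a linear function of
    adj G z ([metric_proj_rangeE]). All conclusions are thus read off one limit
    ([iterates_converge]), KKT points being primal and dual optimal by convex
    duality ([KKT_saddle]). *)

(** * Inner products, bounded sequences and linear maps *)

Section inner_product.
Context {R : realType}.
Implicit Types V W : hilbertType R.

Lemma dotDl V (u w v : V) : dot (u + w) v = dot u v + dot w v.
Proof. by have := dot_linearl v 1 u w; rewrite scale1r mul1r. Qed.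

Lemma dot0l V (v : V) : dot 0 v = 0.
Proof. by have := dotDl 0 0 v; rewrite addr0; lra. Qed.

Lemma dotZl V a (u v : V) : dot (a *: u) v = a * dot u v.
Proof. by have := dot_linearl v a u 0; rewrite addr0 dot0l addr0. Qed.

Lemma dotNl V (u v : V) : dot (- u) v = - dot u v.
Proof. by rewrite -scaleN1r dotZl mulN1r. Qed.

Lemma dotDr V (v u w : V) : dot v (u + w) = dot v u + dot v w.
Proof. by rewrite dotC dotDl !(dotC v). Qed.

Lemma dotZr V a (v u : V) : dot v (a *: u) = a * dot v u.
Proof. by rewrite dotC dotZl (dotC v). Qed.

Lemma dotNr V (v u : V) : dot v (- u) = - dot v u.
Proof. by rewrite dotC dotNl (dotC v). Qed.

Lemma dot0r V (v : V) : dot v 0 = 0.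
Proof. by rewrite dotC dot0l. Qed.

Definition dot_expand :=
  (dotDl, dotDr, dotNl, dotNr, dotZl, dotZr, dot0l, dot0r).

Lemma dot_suml V (I : Type) (r : seq I) (P : pred I) (u : I -> V) v :
  dot (\sum_(i <- r | P i) u i) v = \sum_(i <- r | P i) dot (u i) v.
Proof. by apply: (big_morph (dot^~ v)) => [x y|]; rewrite ?dotDl ?dot0l. Qed.

Lemma dot_sumr V (I : Type) (r : seq I) (P : pred I) (u : I -> V) v :
  dot v (\sum_(i <- r | P i) u i) = \sum_(i <- r | P i) dot v (u i).
Proof. by rewrite dotC dot_suml; apply: eq_bigr => i _; rewrite dotC. Qed.

Lemma dot_ge0 V (u : V) : 0 <= dot u u.
Proof. by rewrite dotxx sqr_ge0. Qed.

Lemma dot_eq0 V (u : V) : dot u u = 0 -> u = 0.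
Proof. by move/eqP; rewrite dotxx sqrf_eq0 normr_eq0 => /eqP. Qed.

Lemma eq_dot V (u v : V) : (forall w, dot u w = dot v w) -> u = v.
Proof.
move=> h; apply/eqP; rewrite -subr_eq0; apply/eqP/dot_eq0.
by rewrite {1}dotDl dotNl h subrr.
Qed.

Lemma cauchy_schwarz V (u v : V) : `|dot u v| <= `|u| * `|v|.
Proof.
have [->|v0] := eqVneq v 0; first by rewrite dot0r !normr0 mulr0.
rewrite -(@ler_pXn2r _ 2)// ?nnegrE ?mulr_ge0// real_normK ?num_real//.
rewrite exprMn -!dotxx.
have := dot_ge0 (dot v v *: u - dot u v *: v).
rewrite !dot_expand (dotC v u).
have vp : 0 < dot v v by rewrite dotxx exprn_gt0// normr_gt0.
rewrite -(ler_pM2l vp); lra.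
Qed.

Lemma dot_le V (u v : V) : dot u v <= `|u| * `|v|.
Proof. exact: le_trans (ler_norm _) (cauchy_schwarz u v). Qed.

Lemma adj_is_linear V W (A : {linear V -> W}) : linear (adj A).
Proof.
move=> a u v; apply: eq_dot => w.
by rewrite adjE !dot_expand !adjE.
Qed.

HB.instance Definition _ V W (A : {linear V -> W}) :=
  GRing.isLinear.Build R W V _ (adj A) (adj_is_linear A).

Lemma adjD V W (A : {linear V -> W}) u v : adj A (u + v) = adj A u + adj A v.
Proof. exact: linearD. Qed.

Lemma adjB V W (A : {linear V -> W}) u v : adj A (u - v) = adj A u - adj A v.
Proof. exact: linearB. Qed.

Lemma adjEr V W (A : {linear V -> W}) v w : dot v (adj A w) = dot (A v) w.
Proof. by rewrite dotC adjE dotC. Qed.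

Lemma adjK V W (A : {linear V -> W}) v : adj (adj A) v = A v.
Proof. by apply: eq_dot => w; rewrite adjE adjEr. Qed.

(** Every linear form is represented by a vector, so Cauchy-Schwarz bounds the
    coordinates in a basis. *)
Lemma linear_bounded V W (A : {linear V -> W}) :
  exists2 C : R, 0 < C & forall v, `|A v| <= C * `|v|.
Proof.
pose b := vbasis {:V}.
have bP v : v = \sum_i coord b i v *: b`_i.
  by apply: coord_vbasis; rewrite memvf.
exists (1 + \sum_i `|riesz (coord b i : {linear V -> R^o})| * `|A b`_i|).
  by rewrite ltr_pwDl// sumr_ge0// => i _; rewrite mulr_ge0.
move=> v; rewrite {1}(bP v) linear_sum mulrDl mul1r.
rewrite (le_trans (ler_norm_sum _ _ _))// mulr_suml.
rewrite -[leLHS]add0r lerD// ler_sum// => i _.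
rewrite linearZ normrZ (rieszE (coord b i)) mulrAC ler_wpM2r//.
exact: cauchy_schwarz.
Qed.

Lemma linear_cvg V W (A : {linear V -> W}) (v : nat -> V) l :
  v @ \oo --> l -> (A \o v) @ \oo --> A l.
Proof.
move=> vl; have [C C0 AC] := linear_bounded A.
apply/cvgrPdist_lt => e e0; have eC : 0 < e / C by rewrite divr_gt0.
move/cvgrPdist_lt : vl => /(_ _ eC); apply: filterS => k.
rewrite ltr_pdivlMr// mulrC => h; rewrite /= -linearB.
exact: le_lt_trans (AC _) h.
Qed.

Lemma dot_cvg V (u v : nat -> V) a b :
  u @ \oo --> a -> v @ \oo --> b -> (fun k => dot (u k) (v k)) @ \oo --> dot a b.
Proof.
move=> ua vb.
have E w w' : dot w w' = 2^-1 * (`|w + w'| ^+ 2 - `|w| ^+ 2 - `|w'| ^+ 2) :> R.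
  by rewrite -!dotxx !dot_expand (dotC w' w); lra.
rewrite E; under eq_fun do rewrite E.
apply: cvgMr; apply: cvgB; [apply: cvgB|]; rewrite !expr2; apply: cvgM;
  by apply: cvg_norm => //; apply: cvgD.
Qed.

Lemma cvg_sqr_norm_sub V (v : nat -> V) l :
  v @ \oo --> l -> (fun k => `|v k - l| ^+ 2) @ \oo --> (0 : R).
Proof.
move=> vl; under eq_fun do rewrite -dotxx.
have -> : 0 = dot (l - l) (l - l) :> R by rewrite subrr dot0l.
by apply: dot_cvg; (apply: cvgB => //; exact: cvg_cst).
Qed.

Lemma cluster_subsequence (T : pseudoMetricType R) (v : nat -> T) (l : T) :
  cluster (v @ \oo) l ->
  exists s : nat -> nat, (forall j, (j <= s j)%N) /\ (v \o s) @ \oo --> l.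
Proof.
move=> cl.
have ex j : exists k, (j <= k)%N /\ ball l j.+1%:R^-1 (v k).
  have [] := cl [set v k | k in [set k | (j <= k)%N]] (ball l j.+1%:R^-1).
  - by exists j => // k /= jk; exists k.
  - by apply: nbhsx_ballx; rewrite invr_gt0.
  - by move=> _ [[k jk <-] lk]; exists k.
have [s sP] := choice ex.
exists s; split; first by move=> j; case: (sP j).
apply/cvg_ballP => e e0; near=> j.
apply: le_ball (sP j).2; apply: ltW.
by near: j; exact: near_infty_natSinv_lt (PosNum e0).
Unshelve. all: by end_near. Qed.

(** The coordinates in a basis lie in a compact box. *)
Lemma bounded_subsequence V (v : nat -> V) (B : R) :
  (forall k, `|v k| <= B) ->
  exists (l : V) (s : nat -> nat), (forall j, (j <= s j)%N) /\ (v \o s) @ \oo --> l.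
Proof.
move=> vB.
pose b := vbasis {:V}.
have bP w : w = \sum_i coord b i w *: b`_i.
  by apply: coord_vbasis; rewrite memvf.
pose a k : 'rV[R]_(\dim {:V}) := \row_i coord b i (v k).
pose r (a : 'rV[R]_(\dim {:V})) : V := \sum_i a ord0 i *: b`_i.
have ra k : r (a k) = v k.
  by rewrite [RHS]bP; apply: eq_bigr => i _; rewrite mxE.
pose M := \sum_i `|riesz (coord b i : {linear V -> R^o})| * B.
pose K : set 'rV[R]_(\dim {:V}) := [set a | forall i, `[- M, M]%classic (a ord0 i)].
have K_compact : compact K.
  by apply: (@rV_compact _ _ (fun=> `[- M, M]%classic)) => _; exact: segment_compact.
have B0 : 0 <= B := le_trans (normr_ge0 _) (vB 0%N).
have Ka k : K (a k).
  move=> i; rewrite /= mxE in_itv/= -ler_norml (rieszE (coord b i)).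
  rewrite (le_trans (cauchy_schwarz _ _))//.
  rewrite /M (bigD1 i)//= -[leLHS]addr0 lerD//.
    by rewrite ler_wpM2l.
  by rewrite sumr_ge0// => j _; rewrite mulr_ge0.
have [l [_ cl]] : K `&` cluster (a @ \oo) !=set0.
  by apply: K_compact; exists 0%N => // k _; exact: Ka.
have [s [sP as_l]] := cluster_subsequence cl.
exists (r l), s; split => //.
have -> : v \o s = r \o (a \o s) by apply/funext => j; rewrite /= ra.
apply: (cvg_comp _ _ as_l).
rewrite /r; apply: cvg_big => [|i _].
  exact: add_continuous.
by apply: cvgZ; [exact: coord_continuous | exact: cvg_cst].
Qed.

End inner_product.
Arguments linear_cvg {R V W} A {v l}.

Lemma norm_onem_lt1 (R : realDomainType) (a : R) : 0 < a -> a < 2 -> `|1 - a| < 1.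
Proof. by move=> a0 a2; rewrite ltr_norml; apply/andP; split; lra. Qed.

Lemma continuous_addr (R : realType) (V : hilbertType R) (g : V -> V) (a : V) :
  continuous g -> continuous (fun v => g v + a).
Proof. by move=> cg v; apply: cvgD; [exact: cg | exact: cvg_cst]. Qed.

(** * Positive operators and the Moore-Penrose inverse *)

Section positive_operators.
Context {R : realType}.
Implicit Types V W : hilbertType R.

Lemma pos_def_inverse V (A : {linear V -> V}) : pos_def A ->
  exists B : {linear V -> V}, forall v, A (B v) = v.
Proof.
move=> Apos; pose f := linfun A.
have kf : lker f == 0%VS.
  apply/lker0P => u v; rewrite !lfunE /= => Auv.
  apply/eqP; rewrite -subr_eq0; apply/negP => /negP /Apos.
  by rewrite linearB /= Auv subrr dot0r ltxx.
exists (fun_of_lfun (f^-1)%VF : {linear V -> V}) => v.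
by have := lker0_lfunVK kf v; rewrite {1}lfunE.
Qed.

(** With [A w = u], positivity of [A] at [w - C u] bounds [|u|^2] by
    [<u, A u>] once [<w, u> <= C |u|^2]. *)
Lemma pos_def_coercive V (A : {linear V -> V}) : self_adjoint A -> pos_def A ->
  exists2 C : R, 0 < C & forall u, `|u| ^+ 2 <= C * dot u (A u).
Proof.
move=> Asym Apos; have [B AB] := pos_def_inverse Apos.
have [C C0 BC] := linear_bounded B.
exists C => // u; pose w := B u.
have Age0 v : 0 <= dot v (A v).
  by have [->|/Apos/ltW//] := eqVneq v 0; rewrite dot0l.
have := Age0 (w - C *: u).
rewrite linearB [A (C *: u)]linearZ /= AB !dot_expand (Asym w u) AB dotxx => h.
have wu : dot w u <= C * `|u| ^+ 2.
  by rewrite (le_trans (dot_le _ _))// expr2 mulrA ler_wpM2r// BC.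
rewrite -(ler_pM2l C0); lra.
Qed.

(** [A A^*] is self-adjoint, so the whole space is the sum of its kernel and
    its image; the kernel part of [A v] is orthogonal to itself. *)
Lemma pseudo_inverse V W (A : {linear V -> W}) :
  exists J : {linear W -> W}, forall v, A (adj A (J (A v))) = A v.
Proof.
pose f := linfun (A \o adj A).
have fE w : f w = A (adj A w) by rewrite lfunE.
have kf w : f w = 0 -> adj A w = 0.
  by move=> fw; apply: dot_eq0; rewrite adjE -fE fw dot0r.
have fsym u w : dot u (f w) = dot (f u) w by rewrite !fE -adjE adjEr.
have fullE : (lker f + limg f)%VS = fullv.
  apply/eqP; rewrite eqEdim subvf /=.
  rewrite dimv_disjoint_sum.
    by rewrite -(limg_ker_dim f fullv) capfv.
  apply/eqP; rewrite -subv0; apply/subvP => w.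
  rewrite memv_cap memv_ker => /andP[/eqP fw /memv_imgP[a _ wE]].
  rewrite memv0; apply/eqP/dot_eq0.
  by rewrite {2}wE fsym fw dot0l.
exists (fun_of_lfun (f^-1)%VF : {linear W -> W}) => v.
rewrite -fE; apply: limg_lfunVK.
have /memv_addP[m + [i img_i E]] : A v \in (lker f + limg f)%VS by rewrite fullE memvf.
rewrite memv_ker => /eqP fm.
suff m0 : m = 0 by rewrite E m0 add0r.
apply: dot_eq0.
have -> : dot m m = dot m (A v - i) by rewrite E addrK.
have /memv_imgP[a _ ->] := img_i.
by rewrite dotDr dotNr -adjE fsym fm kf// !dot0l subrr.
Qed.

(** [K A] is the orthogonal projection on the range of [adj A]. That it
    factors through [A] is what bounds the projection of [v] by [A v]. *)
Lemma moore_penrose V W (A : {linear V -> W}) : exists K : {linear W -> V},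
  [/\ forall w, exists w', K w = adj A w',
      forall v, A (K (A v)) = A v,
      forall w, K (A (adj A w)) = adj A w &
      forall u v, dot (K (A u)) v = dot u (K (A v))].
Proof.
have [J JP] := pseudo_inverse A.
pose K : {linear W -> V} := adj A \o J.
have AK v : A (K (A v)) = A v by exact: JP.
have Kin w : K w = adj A (J w) by [].
have ortho u v : dot (K (A u)) (v - K (A v)) = 0.
  by rewrite Kin adjE linearB AK subrr dot0r.
have sym u v : dot (K (A u)) v = dot (K (A u)) (K (A v)).
  by rewrite -{1}(subrK (K (A v)) v) dotDr ortho add0r.
exists K; split => //; first by move=> w; exists (J w).
- move=> w; apply/eqP; rewrite -subr_eq0; apply/eqP/dot_eq0.
  have AE : A (K (A (adj A w)) - adj A w) = 0 by rewrite linearB AK subrr.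
  have dE : K (A (adj A w)) - adj A w = adj A (J (A (adj A w)) - w) by rewrite linearB.
  by rewrite {1}dE adjE AE dot0r.
- by move=> u v; rewrite sym [RHS]dotC (sym v u) dotC.
Qed.

End positive_operators.

(** * Summable and quasi-decreasing sequences *)

Lemma cvg_along (W : topologicalType) (v : nat -> W) (l : W) (s : nat -> nat) :
  (forall j, (j <= s j)%N) -> v @ \oo --> l -> (v \o s) @ \oo --> l.
Proof.
move=> sP vl; apply: cvg_comp vl => P [N _ NP]; exists N => // j /= Nj.
by apply: NP; rewrite /= (leq_trans Nj).
Qed.

Section summable_sequences.
Context {R : realType}.
Implicit Types u v e : nat -> R.

Lemma bounded_summable u (B : R) : (forall k, 0 <= u k) ->
  (forall n, series u n <= B) -> cvgn (series u).
Proof.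
move=> u0 uB; apply: nondecreasing_is_cvgn.
  by apply/nondecreasing_seqP => n; rewrite /series /= big_nat_recr//= lerDl.
by exists B => _ [n _ <-].
Qed.

Lemma summable_bounded u : (forall k, 0 <= u k) -> cvgn (series u) ->
  exists2 B, 0 <= B & forall n, series u n <= B.
Proof.
move=> u0 cu; exists (limn (series u)).
  apply: limr_ge => //; near=> n; rewrite /series /= sumr_ge0//.
move=> n; apply: nondecreasing_cvgn_le => //.
by apply/nondecreasing_seqP => m; rewrite /series /= big_nat_recr//= lerDl.
Unshelve. all: by end_near. Qed.

Lemma summable_le u v : (forall k, 0 <= u k) -> (forall k, u k <= v k) ->
  cvgn (series v) -> cvgn (series u).
Proof.
by move=> u0 uv; apply: series_le_cvg => // k; apply: le_trans (uv k).
Qed.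

Lemma cvg_series_add u v : cvgn (series u) -> cvgn (series v) ->
  cvgn (series (fun k => u k + v k)).
Proof. exact: is_cvg_seriesD. Qed.

Lemma cvg_series_scale (a : R) u : cvgn (series u) -> cvgn (series (fun k => a * u k)).
Proof. exact: is_cvg_seriesZ. Qed.

Lemma summable_shift u : (forall k, 0 <= u k) ->
  cvgn (series (fun k => u k.+1)) <-> cvgn (series u).
Proof.
move=> u0; split => cu.
  have [B B0 uB] := summable_bounded (fun k => u0 k.+1) cu.
  apply: (@bounded_summable _ (u 0%N + B)) => // -[|n].
    by rewrite /series /= big_geq// addr_ge0.
  by rewrite /series /= big_nat_recl// lerD2l uB.
have [B B0 uB] := summable_bounded u0 cu.
apply: (@bounded_summable _ B) => // n.
by rewrite (le_trans _ (uB n.+1))// /series /= big_nat_recl// lerDr.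
Qed.

(** The partial sums [S n] satisfy [S (n + 1) <= u 0 + q S n + B]. *)
Lemma summable_contraction u e (q : R) : 0 <= q < 1 ->
  (forall k, 0 <= u k) -> (forall k, 0 <= e k) ->
  (forall k, u k.+1 <= q * u k + e k) ->
  cvgn (series e) -> cvgn (series u).
Proof.
move=> /andP[q0 q1] u0 e0 ue ce; have [B B0 eB] := summable_bounded e0 ce.
apply: (@bounded_summable _ ((u 0%N + B) / (1 - q))) => // n.
rewrite ler_pdivlMr ?subr_gt0//.
have S0 m : 0 <= series u m by rewrite /series /= sumr_ge0.
have : series u n.+1 <= u 0%N + q * series u n + series e n.
  rewrite /series /= big_nat_recl// -addrA lerD2l mulr_sumr -big_split /=.
  exact: ler_sum.
have : series u n <= series u n.+1 by rewrite /series /= big_nat_recr//= lerDl.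
have := eB n; lra.
Qed.

Lemma quasi_decreasing u e k m : (forall k, u k.+1 <= u k + e k) -> (k <= m)%N ->
  u m <= u k + (series e m - series e k).
Proof.
move=> ue; elim: m => [|m IH]; first by rewrite leqn0 => /eqP ->; rewrite subrr addr0.
rewrite leq_eqVlt => /predU1P[->|]; first by rewrite subrr addr0.
rewrite ltnS => /IH {}IH; have := ue m; rewrite seriesSr; lra.
Qed.

Lemma quasi_decreasing_bounded u e : (forall k, 0 <= e k) ->
  (forall k, u k.+1 <= u k + e k) -> cvgn (series e) ->
  exists B, forall k, u k <= B.
Proof.
move=> e0 ue /(summable_bounded e0)[B B0 eB]; exists (u 0%N + B) => k.
have := quasi_decreasing ue (leq0n k); rewrite [series e 0]big_geq//.
have := eB k; lra.
Qed.

(** Small somewhere arbitrarily far implies small from there on, since the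
    remaining increments are small. *)
Lemma quasi_decreasing_cvg0 u e (s : nat -> nat) : (forall k, 0 <= u k) ->
  (forall k, u k.+1 <= u k + e k) -> cvgn (series e) ->
  (forall j, (j <= s j)%N) -> (u \o s) @ \oo --> (0 : R) -> u @ \oo --> (0 : R).
Proof.
move=> u0 ue ce sP us0.
apply/cvgrPdist_lt => d d0; have d2 : 0 < d / 3 by rewrite divr_gt0.
have /cvgrPdist_lt/(_ _ d2)[N _ NP] := ce.
have /cvgrPdist_lt/(_ _ d2)[M _ MP] := us0.
pose k := s (maxn N M).
have Nk : (N <= k)%N by rewrite (leq_trans (leq_maxl N M)).
have uk : u k < d / 3.
  have := MP (maxn N M) (leq_maxr _ _).
  by rewrite /= sub0r normrN ger0_norm.
exists k => // m /= km; rewrite sub0r normrN ger0_norm//.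
have := quasi_decreasing ue km.
have := NP k Nk; have := NP m (leq_trans Nk km); rewrite /= !ltr_norml.
move=> /andP[? ?] /andP[? ?]; lra.
Qed.

Lemma norm_cvg0_summable (W : hilbertType R) (v : nat -> W) :
  cvgn (series (fun k => `|v k|)) -> v @ \oo --> (0 : W).
Proof. by move=> cv; apply/norm_cvg0P; exact: cvg_series_cvg_0. Qed.

End summable_sequences.

(** * The inexact proximal augmented Lagrangian method *)

Section proximal_ALM.
Context {R : realType} {V X : hilbertType R}.
Context (A : {linear X -> V}) (c : X) (h : V -> V) (Phi : V -> set V).
Context (Sigma T : {linear V -> V}) (sigma tau : R).

Definition monotone_relation := forall y g y' g',
  Phi y g -> Phi y' g' -> 0 <= dot (g - g') (y - y').

Definition closed_relation := forall (y g : nat -> V) y' g',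
  (forall k, Phi (y k) (g k)) -> y @ \oo --> y' -> g @ \oo --> g' -> Phi y' g'.

Definition inclusion_solution (u : X) (y : V) :=
  Phi y (- (h y + A u)) /\ adj A y = c.

(** One step for the system [0 \in Phi y + h y + A u], [adj A y = c]. The map
    [h] is evaluated at the previous point, which [Sigma] compensates; [T] is
    the proximal operator and [delta] the error of the inclusion. *)
Definition proximal_ALM_step (u : X) (y : V) (delta : V) (u' : X) (y' : V) :=
  Phi y' (delta - h y - A (u + sigma *: (adj A y' - c))
          - (Sigma (y' - y) + T (y' - y))) /\
  u' = u + (tau * sigma) *: (adj A y' - c).

(** The first two terms alone need not control [y], as [Sigma + T] may be
    degenerate; the residual term makes up for it on the range of [A]. *)
Definition lyapunov (ub : X) (yb : V) (u : X) (y : V) : R :=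
  dot (y - yb) (Sigma (y - yb) + T (y - yb))
  + (tau * sigma)^-1 * `|u - ub| ^+ 2
  + (2 - tau) * sigma * `|adj A y - c| ^+ 2.

Hypothesis Sigma_sym : self_adjoint Sigma.
Hypothesis Sigma_ge0 : pos_semidef Sigma.
Hypothesis T_sym : self_adjoint T.
Hypothesis T_ge : pos_semidef (fun v => T v + 2^-1 *: Sigma v).
Hypothesis pos : pos_def (fun v => T v + 2^-1 *: Sigma v + sigma *: A (adj A v)).
Hypotheses (sigma_gt0 : 0 < sigma) (tau_gt0 : 0 < tau) (tau_lt2 : tau < 2).
Hypothesis h_cont : continuous h.
Hypothesis h_quarter : forall y' yb y : V,
  - (4^-1 * dot (y - y') (Sigma (y - y'))) <= dot (h y' - h yb) (y - yb).
Hypothesis Phi_mono : monotone_relation.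
Hypothesis Phi_closed : closed_relation.

Let energy (d : V) := dot d (T d + 2^-1 *: Sigma d).

(** Monotonicity of [Phi] between [y'] and [yb], with the inner products
    polarized into differences of squares. The quadratic form [Sigma + T] of
    the step [y' - y] comes out negated, [h_quarter] gives back half of
    [Sigma], and the rest is [energy]. *)
Lemma lyapunov_decrease ub yb u y delta u' y' :
  inclusion_solution ub yb -> proximal_ALM_step u y delta u' y' ->
  lyapunov ub yb u' y' + energy (y' - y)
    + (2 - tau) * sigma * `|adj A y - c| ^+ 2
  <= lyapunov ub yb u y + 2 * (`|delta| * `|y' - yb|).
Proof.
move=> [Pb cb] [P' ->]; rewrite /lyapunov /energy -{}cb in P' *.
rewrite -!linearB in P' *.
have := Phi_mono P' Pb; have := h_quarter y yb y'.
have := dot_le delta (y' - yb).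
have -> : y' - y = (y' - yb) - (y - yb) by rewrite opprB addrA subrK.
have -> : u + (tau * sigma) *: adj A (y' - yb) - ub
          = (u - ub) + (tau * sigma) *: adj A (y' - yb) by rewrite addrAC.
have -> : u + sigma *: adj A (y' - yb)
          = ub + ((u - ub) + sigma *: adj A (y' - yb)) by rewrite addrA subrKC.
move: (y' - yb) (y - yb) (u - ub) => e' e w.
rewrite !(linearB, linearD) [in X in _ -> _ -> X -> _]/=.
set r' := adj A e'; set r := adj A e.
have -> : A (sigma *: r') = sigma *: A r' by rewrite linearZ.
rewrite !dot_expand -!dotxx !dot_expand.
have adjAE v : (adj A : {linear V -> X}) v = adj A v by [].
rewrite -!(adjEr A) !adjAE -/r' -/r (dotC r' w).
rewrite (dotC (Sigma e') e') (dotC (T e') e').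
rewrite (Sigma_sym e e') (dotC (Sigma e) e') (T_sym e e') (dotC (T e) e').
have -> : (tau * sigma)^-1 * (dot w w + tau * sigma * dot w r'
      + (tau * sigma * dot w r' + tau * sigma * (tau * sigma * dot r' r')))
   = (tau * sigma)^-1 * dot w w + 2 * dot w r' + tau * (sigma * dot r' r').
  by field; rewrite !gt_eqF.
move=> h1 h2 h3.
lra.
Qed.

Let energy_ge0 d : 0 <= energy d. Proof. exact: T_ge. Qed.

Lemma energy_coercive :
  exists2 C : R, 0 < C & forall d, `|d| ^+ 2 <= C * (energy d + sigma * `|adj A d| ^+ 2).
Proof.
pose Q : {linear V -> V} := (T \+ (2^-1 \*: Sigma)) \+ (sigma \*: (A \o adj A)).
have Qsym : self_adjoint Q.
  move=> v w; rewrite /= !dot_expand T_sym Sigma_sym.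
  by rewrite -(adjEr A) -(adjE A).
have [C C0 CP] := pos_def_coercive Qsym pos.
exists C => // d; rewrite (le_trans (CP d))// ler_wpM2l ?(ltW C0)//.
by rewrite /= /energy !dot_expand -(adjE A) dotxx.
Qed.

Lemma lyapunov_coercive : exists2 K : R, 0 < K & forall ub yb u y, adj A yb = c ->
  [/\ 0 <= lyapunov ub yb u y,
     `|y - yb| <= K * Num.sqrt (lyapunov ub yb u y) &
     `|u - ub| <= K * Num.sqrt (lyapunov ub yb u y)].
Proof.
have [C C0 CP] := energy_coercive.
(* [2 - tau] may be less than 1, so only [m] times the definite form is bounded. *)
pose m := Num.min 1 (2 - tau).
have m0 : 0 < m by rewrite lt_min ltr01 subr_gt0.
have m1 : m <= 1 by rewrite ge_min lexx.
have m2 : m <= 2 - tau by rewrite ge_min lexx orbT.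
have ts : 0 < tau * sigma by rewrite mulr_gt0.
pose K := Num.sqrt (m^-1 * C + tau * sigma).
have mC : 0 < m^-1 * C by rewrite mulr_gt0// invr_gt0.
have K2 : K ^+ 2 = m^-1 * C + tau * sigma by rewrite sqr_sqrtr// ltW// addr_gt0.
have K0 : 0 < K by rewrite sqrtr_gt0 addr_gt0.
exists K => // ub yb u y cb; rewrite /lyapunov -cb -linearB.
move: (y - yb) (u - ub) => e w.
pose L1 := dot e (Sigma e + T e) + (2 - tau) * sigma * `|adj A e| ^+ 2.
pose L2 := (tau * sigma)^-1 * `|w| ^+ 2.
have L20 : 0 <= L2 by rewrite mulr_ge0// ?invr_ge0 ?ltW.
have sA : 0 <= sigma * `|adj A e| ^+ 2 by rewrite mulr_ge0// ltW.
have sA' : m * (sigma * `|adj A e| ^+ 2) <= (2 - tau) * (sigma * `|adj A e| ^+ 2).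
  exact: ler_wpM2r.
have E0 : 0 <= energy e by [].
have E1 : m * energy e <= 1 * energy e by exact: ler_wpM2r.
have L1E : m * (energy e + sigma * `|adj A e| ^+ 2) <= L1.
  have S0 := Sigma_ge0 e.
  move: E1 sA'; rewrite /L1 /energy !dot_expand. lra.
have L10 : 0 <= L1 by apply: le_trans L1E; rewrite mulr_ge0 ?addr_ge0// ltW.
rewrite (_ : _ + _ + _ = L1 + L2); last by rewrite /L1 /L2; ring.
have le_sqrt x (y' : R) : 0 <= x -> x ^+ 2 <= K ^+ 2 * y' -> x <= K * Num.sqrt y'.
  move=> x0 xy; rewrite -(ger0_norm x0) -sqrtr_sqr -(ger0_norm (ltW K0)).
  by rewrite -(sqrtr_sqr K) -sqrtrM ?sqr_ge0// ler_wsqrtr.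
split; first by rewrite addr_ge0.
- apply: le_sqrt => //; rewrite K2 (le_trans (CP e))//.
  apply: (@le_trans _ _ (m^-1 * C * L1)).
    rewrite -[X in C * X](mulKf (lt0r_neq0 m0)) mulrCA mulrA.
    by rewrite ler_wpM2l ?(ltW mC).
  have := mulr_ge0 (ltW ts) L10; have := mulr_ge0 (ltW ts) L20.
  have := mulr_ge0 (ltW mC) L20; lra.
- apply: le_sqrt => //; rewrite K2.
  have wE : `|w| ^+ 2 = tau * sigma * L2 by rewrite /L2 mulrA mulfV ?mul1r// gt_eqF.
  have := mulr_ge0 (ltW ts) L10; have := mulr_ge0 (ltW mC) L20.
  have := mulr_ge0 (ltW mC) L10; rewrite wE; lra.
Qed.

(** In a step [Phi y' g], the vector [g] tends to the one of the limiting
    inclusion. *)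
Lemma step_direction_cvg (u : nat -> X) (y y' delta : nat -> V) us ys :
  u @ \oo --> us -> y @ \oo --> ys -> y' @ \oo --> ys -> delta @ \oo --> (0 : V) ->
  adj A ys = c ->
  (fun k => delta k - h (y k) - A (u k + sigma *: (adj A (y' k) - c))
      - (Sigma (y' k - y k) + T (y' k - y k))) @ \oo --> - (h ys + A us).
Proof.
move=> cu cy cy' cd ysc.
have d0 : (fun k => y' k - y k) @ \oo --> (0 : V).
  by rewrite -(subrr ys); exact: cvgB.
have r0 : (fun k => adj A (y' k) - c) @ \oo --> (0 : X).
  rewrite -[X in _ --> X](subrr c) -[X in _ --> X - _]ysc.
  apply: cvgB; last exact: cvg_cst.
  exact: (linear_cvg (adj A : {linear V -> X}) cy').
have -> : - (h ys + A us) = 0 - h ys - A (us + sigma *: 0) - (Sigma 0 + T 0).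
  by rewrite scaler0 !linear0 !addr0 !subr0 add0r opprD.
apply: cvgB; last by apply: cvgD; apply: linear_cvg.
apply: cvgB.
  by apply: cvgB => //; apply: (cvg_comp _ _ cy); exact: h_cont.
by apply: (linear_cvg A); apply: cvgD => //; apply: cvgZ => //; exact: cvg_cst.
Qed.

Section iterates.
Context (u : nat -> X) (y delta : nat -> V).
Hypothesis step : forall k, proximal_ALM_step (u k) (y k) (delta k) (u k.+1) (y k.+1).
Hypothesis delta_summable : cvgn (series (fun k => `|delta k|)).

Let psi ub yb k := Num.sqrt (lyapunov ub yb (u k) (y k)).

Let psi_ge0 ub yb k : 0 <= psi ub yb k. Proof. exact: sqrtr_ge0. Qed.

(** The error [2 |delta| |y' - yb|] is measured by the new point, hence at most
    [2 K |delta|] times the new [psi]; dividing a difference of squares by a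
    sum makes it an additive error on [psi]. *)
Lemma lyapunov_quasi_decreasing : exists2 K : R, 0 < K &
  forall ub yb, inclusion_solution ub yb ->
  forall k, psi ub yb k.+1 <= psi ub yb k + 2 * K * `|delta k|.
Proof.
have [K K0 KP] := lyapunov_coercive; exists K => // ub yb sol k.
have [L0 _ _] := KP ub yb (u k) (y k) sol.2.
have [L1 e1 _] := KP ub yb (u k.+1) (y k.+1) sol.2.
have := lyapunov_decrease sol (step k).
have E0 := energy_ge0 (y k.+1 - y k).
have r0 : 0 <= (2 - tau) * sigma * `|adj A (y k) - c| ^+ 2.
  by rewrite mulr_ge0// mulr_ge0 ?subr_ge0 ?ltW.
rewrite -(sqr_sqrtr L1) -(sqr_sqrtr L0) -/(psi _ _ _) -/(psi _ _ _).
rewrite -/(energy _) => dec.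
have de : `|delta k| * `|y k.+1 - yb| <= `|delta k| * (K * psi ub yb k.+1).
  exact: ler_wpM2l.
have p0 := psi_ge0 ub yb k; have p1 := psi_ge0 ub yb k.+1.
have d0 : 0 <= K * `|delta k| by rewrite mulr_ge0 ?(ltW K0).
rewrite leNgt; apply/negP => lt.
have : psi ub yb k.+1 ^+ 2 <= psi ub yb k ^+ 2 + 2 * K * `|delta k| * psi ub yb k.+1.
  lra.
move: lt d0 p0 p1; nra.
Qed.

(** The decreases of the Lyapunov function are summable because [psi] is
    bounded; they dominate the squared residuals and, by [energy_coercive]
    together with the residuals, the squared steps. *)
Lemma residual_and_step_cvg0 ub yb : inclusion_solution ub yb ->
  (fun k => adj A (y k) - c) @ \oo --> (0 : X) /\
  (fun k => y k.+1 - y k) @ \oo --> (0 : V).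
Proof.
move=> sol.
have [K K0 KP] := lyapunov_coercive; have [K' K'0 qd] := lyapunov_quasi_decreasing.
have [B psiB] : exists B, forall k, psi ub yb k <= B.
  apply: (@quasi_decreasing_bounded _ _ (fun k => 2 * K' * `|delta k|)).
  - by move=> k; rewrite mulr_ge0// mulr_ge0 ?ltW.
  - exact: qd.
  - exact: cvg_series_scale.
pose w k := energy (y k.+1 - y k) + (2 - tau) * sigma * `|adj A (y k) - c| ^+ 2.
have r0 k : 0 <= (2 - tau) * sigma * `|adj A (y k) - c| ^+ 2.
  by rewrite mulr_ge0// mulr_ge0 ?subr_ge0 ?ltW.
have w0 k : 0 <= w k by rewrite addr_ge0.
have [D D0 DP] := summable_bounded (fun k => normr_ge0 (delta k)) delta_summable.
have sum_w n : series w n + lyapunov ub yb (u n) (y n) <=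
    lyapunov ub yb (u 0%N) (y 0%N) + 2 * K * B * series (fun k => `|delta k|) n.
  elim: n => [|n IH]; first by rewrite /series /= !big_geq// mulr0 addr0 add0r.
  rewrite !seriesSr.
  have := lyapunov_decrease sol (step n); rewrite -/(energy _).
  have [_ e1 _] := KP ub yb (u n.+1) (y n.+1) sol.2.
  have : `|delta n| * `|y n.+1 - yb| <= `|delta n| * (K * B).
    by rewrite ler_wpM2l// (le_trans e1)// ler_wpM2l ?(ltW K0)//; exact: psiB.
  rewrite {2}/w; move: IH; lra.
have B0 : 0 <= B := le_trans (psi_ge0 ub yb 0%N) (psiB 0%N).
have w_summable : cvgn (series w).
  apply: (@bounded_summable _ _ (lyapunov ub yb (u 0%N) (y 0%N) + 2 * K * B * D)) => // n.
  have [L0 _ _] := KP ub yb (u n) (y n) sol.2.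
  have := sum_w n.
  have : 2 * K * B * series (fun k => `|delta k|) n <= 2 * K * B * D.
    by rewrite ler_wpM2l// !mulr_ge0 ?(ltW K0).
  lra.
have w_cvg0 := cvg_series_cvg_0 w_summable.
have sq0 (W : hilbertType R) (v : nat -> W) (a : nat -> R) (C : R) :
    (forall k, `|v k| ^+ 2 <= C * a k) -> a @ \oo --> (0 : R) -> v @ \oo --> (0 : W).
  move=> va a0; apply/norm_cvg0P.
  have ca : (fun k => Num.sqrt (C * a k)) @ \oo --> (0 : R).
    rewrite -[X in _ --> X]sqrtr0 -(mulr0 C).
    apply: continuous_cvg; first exact: sqrt_continuous.
    by apply: cvgMr.
  apply: (squeeze_cvgr _ (cvg_cst _) ca); near=> k.
  by rewrite normr_ge0 -[leLHS]normr_id -sqrtr_sqr ler_wsqrtr.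
have res0 : (fun k => adj A (y k) - c) @ \oo --> (0 : X).
  apply: (sq0 _ _ w ((2 - tau) * sigma)^-1) => // k.
  rewrite -ler_pdivrMl ?invr_gt0 ?mulr_gt0 ?subr_gt0// invrK.
  by rewrite /w lerDr.
split=> //.
have [C C0 CP] := energy_coercive.
apply: (sq0 _ _ (fun k => w k
    + sigma * `|(adj A (y k.+1) - c) - (adj A (y k) - c)| ^+ 2) C).
  move=> k; rewrite (le_trans (CP _))// ler_wpM2l ?(ltW C0)//.
  rewrite linearB opprB addrA subrK /= lerD2r /w lerDl; exact: r0.
rewrite -[X in _ --> X](addr0 0); apply: cvgD => //.
rewrite -[X in _ --> X](mulr0 sigma); apply: cvgMr.
rewrite -[X in _ --> X](mulr0 (0 : R)).
under eq_fun do rewrite expr2.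
have n0 : (fun k => `|adj A (y k.+1) - c - (adj A (y k) - c)|) @ \oo --> (0 : R).
  rewrite -(normr0 X) -[X in `|X|](subr0 0); apply: cvg_norm; apply: cvgB => //.
  by have := res0; rewrite -(cvg_shiftS (fun k => adj A (y k) - c)).
exact: cvgM.
Unshelve. all: by end_near. Qed.

(** The Lyapunov function at one solution bounds the iterates and sums up the
    residuals and steps, so a limit of a subsequence solves the inclusion; the
    Lyapunov function at that solution is then small arbitrarily late. *)
Theorem proximal_ALM_converges : (exists ub yb, inclusion_solution ub yb) ->
  exists us ys, [/\ inclusion_solution us ys, u @ \oo --> us & y @ \oo --> ys].
Proof.
move=> [ub [yb sol]].
have [K K0 KP] := lyapunov_coercive; have [K' K'0 qd] := lyapunov_quasi_decreasing.
have K'd : cvgn (series (fun k => 2 * K' * `|delta k|)) by exact: cvg_series_scale.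
have [res0 step0] := residual_and_step_cvg0 sol.
have [B psiB] : exists B, forall k, psi ub yb k <= B.
  apply: (@quasi_decreasing_bounded _ _ (fun k => 2 * K' * `|delta k|)) => //.
  - by move=> k; rewrite mulr_ge0// mulr_ge0 ?ltW.
  - exact: qd.
have yB k : `|y k| <= K * B + `|yb|.
  rewrite -{1}(subrK yb (y k)) (le_trans (ler_normD _ _))// lerD2r.
  have [_ e _] := KP ub yb (u k) (y k) sol.2.
  by rewrite (le_trans e)// ler_wpM2l ?(ltW K0)//; exact: psiB.
have uB k : `|u k| <= K * B + `|ub|.
  rewrite -{1}(subrK ub (u k)) (le_trans (ler_normD _ _))// lerD2r.
  have [_ _ e] := KP ub yb (u k) (y k) sol.2.
  by rewrite (le_trans e)// ler_wpM2l ?(ltW K0)//; exact: psiB.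
have [ys [s1 [s1P ys1]]] := bounded_subsequence yB.
have [us [s2 [s2P us2]]] := bounded_subsequence (fun k => uB (s1 k)).
pose s := s1 \o s2.
have sP j : (j <= s j)%N by rewrite (leq_trans (s2P j))// s1P.
have ys_cvg : (y \o s) @ \oo --> ys := cvg_along s2P ys1.
have us_cvg : (u \o s) @ \oo --> us by [].
have dy := cvg_along sP step0.
have ySs : (fun j => y (s j).+1) @ \oo --> ys.
  rewrite -[X in _ --> X](addr0 ys).
  have -> : (fun j => y (s j).+1) = (fun j => y (s j) + (y (s j).+1 - y (s j))).
    by apply/funext => j; rewrite subrKC.
  exact: cvgD.
have rs := cvg_along sP res0.
have delta0 : delta @ \oo --> (0 : V).
  by apply/norm_cvg0P; exact: cvg_series_cvg_0.
have ysc : adj A ys = c.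
  apply/eqP; rewrite -subr_eq0; apply/eqP.
  apply: (cvg_unique _ _ rs) => //=.
  apply: cvgB; last exact: cvg_cst.
  exact: (linear_cvg (adj A : {linear V -> X}) ys_cvg).
have sols : inclusion_solution us ys.
  split=> //; apply: (Phi_closed (fun j => (step (s j)).1) ySs).
  exact: (step_direction_cvg us_cvg ys_cvg ySs (cvg_along sP delta0)).
have psi0 : psi us ys @ \oo --> (0 : R).
  apply: (quasi_decreasing_cvg0 (psi_ge0 us ys) (qd _ _ sols) K'd sP).
  rewrite -[X in _ --> X]sqrtr0.
  apply: continuous_cvg; first exact: sqrt_continuous.
  rewrite /lyapunov.
  have e0 : (fun k => y (s k) - ys) @ \oo --> (0 : V).
    by rewrite -(subrr ys); apply: cvgB => //; exact: cvg_cst.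
  rewrite -[X in _ --> X](addr0 0); apply: cvgD.
    rewrite -[X in _ --> X](addr0 0); apply: cvgD.
      rewrite -(dot0l (Sigma 0 + T 0)); apply: dot_cvg => //.
      by apply: cvgD; apply: linear_cvg.
    rewrite -[X in _ --> X](mulr0 (tau * sigma)^-1); apply: cvgMr.
    exact: cvg_sqr_norm_sub.
  rewrite -[X in _ --> X](mulr0 ((2 - tau) * sigma)); apply: cvgMr.
  have := cvg_sqr_norm_sub rs; by under eq_fun do rewrite subr0.
have from_psi (W : hilbertType R) (v : nat -> W) l :
    (forall k, `|v k - l| <= K * psi us ys k) -> v @ \oo --> l.
  move=> vl; apply/cvgrPdist_lt => e e0.
  have eK : 0 < e / K by rewrite divr_gt0.
  have /cvgrPdist_lt/(_ _ eK) := psi0; apply: filterS => k.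
  rewrite sub0r normrN ger0_norm ?psi_ge0// ltr_pdivlMr// mulrC distrC.
  exact: le_lt_trans.
by exists us, ys; split => //; apply: from_psi => k;
  have [] := KP us ys (u k) (y k) sols.2.
Qed.

End iterates.
End proximal_ALM.

(** * Convex functions and subdifferentials *)

Section smooth_convex.
Context {R : realType} {V : hilbertType R}.
Implicit Types f : V -> R.

Lemma convex_gradient f : convex_function [set: V] f ->
  forall u, differentiable f u -> forall v, f u + dot (grad f u) (v - u) <= f v.
Proof.
move=> fconv u fdiff v.
have quot t : 0 < t < 1 -> t^-1 * (f (t *: (v - u) + u) - f u) <= f v - f u.
  move=> /andP[t0 t1]; rewrite ler_pdivrMl//.
  have h : f (t *: v + (1 - t) *: u) <= t * f v + (1 - t) * f u :=
    fconv (Itv01 (ltW t0) (ltW t1)) v u (mem_setT _) (mem_setT _).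
  have -> : t *: (v - u) + u = t *: v + (1 - t) *: u.
    by rewrite scalerBr scalerBl scale1r -addrA [- _ + u]addrC.
  by lra.
rewrite -lerBrDl -gradE -deriveE//.
apply: (@cvgr_to_le R (0 : R)^'+ _ R (fun t => t^-1 * (f (t *: (v - u) + u) - f u))).
  by apply: cvg_dnbhs_at_right; exact: (@diff_derivable _ _ _ f u (v - u) fdiff).
by near=> t; apply: quot; apply/andP; split => //; near: t; exact: nbhs_right_lt.
Unshelve. all: by end_near. Qed.

(** Cocoercivity of the gradient in the seminorm of [Sigma], with [Sigma]
    never inverted: test convexity and majorization at the points moved by
    [(y - y') / 2], one from [y'] and the other, backwards, from [yb]. *)
Lemma gradient_quarter f (Sigma : {linear V -> V}) :
  convex_function [set: V] f -> (forall y, differentiable f y) ->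
  (forall y y', f y <= f y' + dot (grad f y') (y - y')
                       + 2^-1 * dot (y - y') (Sigma (y - y'))) ->
  forall y' yb y, - (4^-1 * dot (y - y') (Sigma (y - y')))
    <= dot (grad f y' - grad f yb) (y - yb).
Proof.
move=> fconv fdiff fmaj y' yb y; pose h := 2^-1 *: (y - y').
have hE : y - yb = (y' - yb) + 2 *: h.
  by rewrite /h scalerA mulfV// scale1r [RHS]addrC addrA subrK.
have -> : y - y' = 2 *: h by rewrite /h scalerA mulfV// scale1r.
rewrite hE; move: h {hE} => h.
have := fmaj (y' + h) y'; have := fmaj (yb - h) yb.
have := convex_gradient fconv (fdiff yb) (y' + h).
have := convex_gradient fconv (fdiff y') (yb - h).
rewrite [y' + h]addrC addrK -[yb - h - yb]addrAC subrr add0r.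
rewrite ![Sigma (2 *: h)]linearZ ![Sigma (- h)]linearN.
move: (grad f y') (grad f yb) => a b; rewrite !dot_expand; lra.
Qed.

End smooth_convex.

Section convex_subdifferential.
Context {R : realType} {V : hilbertType R}.
Implicit Types phi : V -> \bar R.

Lemma subdiff_fin phi u g : proper_function phi -> subdiff phi u g ->
  phi u \is a fin_num.
Proof.
move=> [phiN [v vy]] ug; have {ug} : (phi u + (dot g (v - u))%:E <= phi v)%E.
  exact: ug.
by have := phiN u; case uE: (phi u) => [//||//] _; case: (phi v) vy.
Qed.

Lemma subdiff_le phi u g v (a b : R) : subdiff phi u g ->
  phi u = a%:E -> phi v = b%:E -> a + dot g (v - u) <= b.
Proof.
move=> ug uE vE; have : (phi u + (dot g (v - u))%:E <= phi v)%E by exact: ug.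
by rewrite uE vE -EFinD lee_fin.
Qed.

Lemma subdiff_monotone phi u g u' g' : proper_function phi ->
  subdiff phi u g -> subdiff phi u' g' -> 0 <= dot (g - g') (u - u').
Proof.
move=> pphi ug ug'.
have /fineK/esym E := subdiff_fin pphi ug.
have /fineK/esym E' := subdiff_fin pphi ug'.
have := subdiff_le ug E E'; have := subdiff_le ug' E' E.
rewrite !dot_expand; lra.
Qed.

Lemma subdiff_closed phi (u g : nat -> V) us gs :
  proper_function phi -> lower_semicontinuous phi ->
  (forall k, subdiff phi (u k) (g k)) -> u @ \oo --> us -> g @ \oo --> gs ->
  subdiff phi us gs.
Proof.
move=> pphi lsc ug cu cg v.
have [->|vy] := eqVneq (phi v) +oo%E; first by rewrite leey.
have [b vE] : exists b, phi v = b%:E.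
  by have := pphi.1 v; case: (phi v) vy => // r; exists r.
rewrite vE leNgt; apply/negP => lt.
have : exists2 a, b - dot gs (v - us) < a & (a%:E < phi us)%E.
  have := pphi.1 us; case: (phi us) lt => // [r|_ _].
    rewrite -EFinD lte_fin -ltrBlDr => lt _; have [] := midf_lt lt => ? ?.
    by eexists; last by rewrite lte_fin; eassumption.
  by exists (b - dot gs (v - us) + 1); rewrite ?ltrDl ?ltry.
move=> [a ba /lsc[W Wus aW]].
suff : a <= b - dot gs (v - us) by rewrite leNgt ba.
have cb : (fun k => b - dot (g k) (v - u k)) @ \oo --> b - dot gs (v - us).
  apply: cvgB; first exact: cvg_cst.
  by apply: dot_cvg => //; apply: cvgB => //; exact: cvg_cst.
apply: (cvgr_to_ge cb); near=> k.
have Wk : W (u k) by near: k; exact: cu.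
have /fineK/esym E := subdiff_fin pphi (ug k).
have := aW _ Wk; rewrite E lte_fin => /ltW /le_trans; apply.
by rewrite lerBrDr; exact: subdiff_le (ug k) E vE.
Unshelve. all: by end_near. Qed.

(** Lower semicontinuity bounds the values from below, the subgradients at the
    points [u k] from above. *)
Lemma subdiff_value_cvg phi (u g : nat -> V) (us gs : V) :
  proper_function phi -> lower_semicontinuous phi ->
  (forall k, subdiff phi (u k) (g k)) -> u @ \oo --> us -> g @ \oo --> gs ->
  (fun k => fine (phi (u k))) @ \oo --> (fine (phi us) : R).
Proof.
move=> pphi lsc ug cu cg.
have usE : phi us = (fine (phi us))%:E.
  by rewrite fineK//; exact: subdiff_fin (subdiff_closed pphi lsc ug cu cg).
have cb : (fun k => dot (g k) (u k - us)) @ \oo --> (0 : R).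
  rewrite -(dot0r gs) -(subrr us).
  by apply: dot_cvg => //; apply: cvgB => //; exact: cvg_cst.
apply/cvgrPdist_lt => e e0; near=> k.
have /fineK/esym E := subdiff_fin pphi (ug k).
rewrite distrC ltr_norml; apply/andP; split.
  rewrite ltrBrDl -lte_fin -E; near: k.
  have [W Wus WP] : exists2 W : set V, nbhs us W & forall v, W v ->
      ((fine (phi us) + - e)%:E < phi v)%E.
    by apply: lsc; rewrite usE lte_fin gtrDl oppr_lt0.
  have : \forall j \near \oo, W (u j) by exact: cu.
  by apply: filterS => j; exact: WP.
have := subdiff_le (ug k) E usE.
have : dot (g k) (u k - us) < e by near: k; exact: cvgr_lt cb _ e0.
rewrite -[u k - us]opprB dotNr; lra.
Unshelve. all: by end_near. Qed.

Lemma le0_of_le_small (x K : R) : (forall t, 0 < t < 1 -> x <= K * t) -> x <= 0.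
Proof.
move=> h; rewrite leNgt; apply/negP => x0.
have d0 : 0 < 2 * (`|K| + x) by rewrite mulr_gt0// ltr_wpDl.
have t1 : 0 < x / (2 * (`|K| + x)) < 1.
  by rewrite divr_gt0//= ltr_pdivrMr// mul1r; have := normr_ge0 K; lra.
have := h _ t1; rewrite mulrA ler_pdivlMr//.
have := ler_wpM2r (ltW x0) (ler_norm K); have := normr_ge0 K; nra.
Qed.

(** Along a segment the quadratic error in [q] is of second order, so the
    linear part of [q] splits off the subgradient. *)
Lemma subdiff_smooth phi (q : V -> R) u g a (C : R) :
  proper_function phi -> econvex_function phi ->
  (forall v, q v <= q u + dot a (v - u) + C * `|v - u| ^+ 2) ->
  subdiff (fun v => (phi v + (q v)%:E)%E) u g -> subdiff phi u (g - a).
Proof.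
move=> pphi cphi qq ug.
have pq : proper_function (fun v => (phi v + (q v)%:E)%E).
  split=> [v|].
    by have := pphi.1 v; case: (phi v).
  by case: pphi => _ [v]; exists v; case: (phi v) p.
have ufin : phi u \is a fin_num.
  by have := subdiff_fin pq ug; case: (phi u).
have uE := esym (fineK ufin); set b := fine (phi u) in uE.
move=> v; have [->|vy] := eqVneq (phi v) +oo%E; first by rewrite leey.
have [d vE] : exists d, phi v = d%:E.
  by have := pphi.1 v; case: (phi v) vy => // r; exists r.
rewrite uE vE -EFinD lee_fin -subr_le0.
apply: (@le0_of_le_small _ (C * `|v - u| ^+ 2)) => t /andP[t0 t1].
have := cphi v u t; rewrite t0 t1 => /(_ isT); rewrite uE vE -!EFinM -EFinD.
set w := t *: v + (1 - t) *: u.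
have wu : w - u = t *: (v - u).
  by rewrite /w scalerBl scale1r [u - _]addrC addrA addrK scalerBr.
case wE : (phi w) (pphi.1 w) => [d'| |]// _; rewrite lee_fin => h.
have := ug w; rewrite uE wE -!EFinD lee_fin => g_le.
have := qq w; move: g_le; rewrite wu dotZr normrZ gtr0_norm// !dotZr.
rewrite dotDl dotNl exprMn; move: (v - u) h => e h g_le q_le.
rewrite -(ler_pM2l t0); lra.
Qed.

End convex_subdifferential.

(** * Products of Hilbert spaces *)

(* The same name also denotes the gluing of two functions. *)
Local Notation glue := Defs.glue.

Section hilbert_products.
Context {R : realType} {n : nat} {Y : 'I_n.+1 -> hilbertType R}.
Local Notation V := (hprod Y).

Lemma hprodP (u v : V) : (forall i, u i = v i) -> u = v.
Proof. exact: functional_extensionality_dep. Qed.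

Definition hcoord (i : 'I_n.+1) (v : V) : Y i := v i.

Lemma hcoord_is_linear i : linear (hcoord i).
Proof. by []. Qed.

HB.instance Definition _ i :=
  GRing.isLinear.Build R V (Y i) _ (hcoord i) (hcoord_is_linear i).

Lemma hprod_sumE (I : Type) (r : seq I) (P : pred I) (u : I -> V) i :
  (\sum_(j <- r | P j) u j) i = \sum_(j <- r | P j) u j i.
Proof. exact: (linear_sum (hcoord i : {linear V -> Y i})). Qed.

Lemma embedE i (u : Y i) : embed u i = u.
Proof. exact: dfwithin. Qed.

Lemma embed_neq i (u : Y i) j : i != j -> embed u j = 0.
Proof. by move=> ij; rewrite /embed dfwithout. Qed.

Lemma embed_is_linear i : linear (@embed R n Y i).
Proof.
move=> a u v; apply: hprodP => j; rewrite hprodDE hprodZE.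
have [<-|ij] := eqVneq i j; first by rewrite !embedE.
by rewrite !embed_neq// scaler0 addr0.
Qed.

HB.instance Definition _ i :=
  GRing.isLinear.Build R (Y i) V _ (@embed R n Y i) (@embed_is_linear i).

Lemma dot_embedl i (u : Y i) (v : V) : dot (embed u) v = dot u (v i).
Proof.
rewrite hprod_dotE (bigD1 i)//= embedE big1 ?addr0// => j ji.
by rewrite embed_neq ?dot0l// eq_sym.
Qed.

Lemma dot_embedr i (u : Y i) (v : V) : dot v (embed u) = dot (v i) u.
Proof. by rewrite dotC dot_embedl dotC. Qed.

Lemma norm_embed i (u : Y i) : `|embed u| = `|u|.
Proof.
by apply/eqP; rewrite -(@eqrXn2 _ 2)// -!dotxx dot_embedl embedE.
Qed.

Lemma hprod_embed_sum (v : V) : v = \sum_i embed (v i).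
Proof.
apply: hprodP => i; rewrite hprod_sumE (bigD1 i)//= embedE big1 ?addr0// => j ji.
by rewrite embed_neq.
Qed.

Lemma norm_hprod_le (v : V) : `|v| <= \sum_i `|v i|.
Proof.
rewrite {1}(hprod_embed_sum v) (le_trans (ler_norm_sum _ _ _))// ler_sum// => i _.
by rewrite norm_embed.
Qed.

Lemma glueE (u : V) i (v : Y i) (w : V) j : glue u v w j =
  if i == j then embed v j else if (j < i)%N then u j else w j.
Proof.
rewrite /glue; have [<-|ij] := eqVneq i j; first by rewrite dfwithin embedE.
by rewrite dfwithout.
Qed.

Lemma glue_in (u : V) i (v : Y i) (w : V) : glue u v w i = v.
Proof. exact: dfwithin. Qed.

Lemma glueB (u y : V) i (v : Y i) (w : V) :
  glue u v w - y = glue (u - y) (v - y i) (w - y).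
Proof.
apply: hprodP => j; rewrite hprodBE !glueE; case: eqVneq => [<-|_].
  by rewrite !embedE.
by case: ifP.
Qed.

Lemma glue_embed (u : V) i (v v' : Y i) (w : V) :
  glue u v' w = glue u v w + embed (v' - v).
Proof.
apply: hprodP => j; rewrite hprodDE !glueE; case: eqVneq => [<-|ij].
  by rewrite !embedE subrKC.
by rewrite embed_neq// addr0.
Qed.

Lemma hprod_choice (P : forall i, Y i -> Prop) :
  (forall i, exists u, P i u) -> exists v : V, forall i, P i (v i).
Proof. by move=> h; exists (fun i => sval (cid (h i))) => i; exact: svalP. Qed.

End hilbert_products.

(** * Block splitting and the symmetric Gauss-Seidel sweep *)

Section block_splitting.
Context {R : realType} {n : nat} {Y : 'I_n.+1 -> hilbertType R}.
Local Notation V := (hprod Y).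
Implicit Types M : {linear V -> V}.

Definition block_part (P : rel 'I_n.+1) (M : V -> V) (y : V) : V :=
  fun i => \sum_(j | P i j) M (embed (y j)) i.

Definition upper := block_part (fun i j => (i < j)%N).
Definition lower := block_part (fun i j => (j < i)%N).
Definition bdiag (M : V -> V) (y : V) : V := fun i => M (embed (y i)) i.

Lemma block_part_is_linear P M : linear (block_part P M).
Proof.
move=> a u v; apply: hprodP => i; rewrite hprodDE hprodZE /block_part.
rewrite scaler_sumr -big_split /=; apply: eq_bigr => j _.
by rewrite hprodDE hprodZE !linearP.
Qed.

HB.instance Definition _ P M :=
  GRing.isLinear.Build R V V _ (block_part P M) (block_part_is_linear P M).

Lemma bdiag_is_linear M : linear (bdiag M).
Proof.
move=> a u v; apply: hprodP => i; rewrite hprodDE hprodZE /bdiag.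
by rewrite hprodDE hprodZE !linearP.
Qed.

HB.instance Definition _ M :=
  GRing.isLinear.Build R V V _ (bdiag M) (bdiag_is_linear M).

Lemma block_split M y : M y = lower M y + bdiag M y + upper M y.
Proof.
apply: hprodP => i; rewrite {1}(hprod_embed_sum y) linear_sum hprod_sumE.
rewrite (bigID (fun j : 'I_n.+1 => (j < i)%N)) /= !hprodDE -addrA.
congr (_ + _); rewrite (bigD1 i) ?ltnn//=; congr (_ + _).
by apply: eq_bigl => j; rewrite -leqNgt ltn_neqAle eq_sym andbC.
Qed.

Lemma apply_glue M (u : V) i (v : Y i) (w : V) :
  M (glue u v w) i = lower M u i + M (embed v) i + upper M w i.
Proof.
rewrite block_split !hprodDE /bdiag glue_in; congr (_ + _ + _);
  apply: eq_bigr => j ij; rewrite glueE.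
  by rewrite -(inj_eq val_inj) gtn_eqF// ij.
by rewrite -(inj_eq val_inj) ltn_eqF// ltnNge (ltnW ij).
Qed.

Lemma dot_upper M (u v : V) : self_adjoint M ->
  dot (upper M u) v = dot u (lower M v).
Proof.
move=> Msym; rewrite !hprod_dotE.
transitivity (\sum_(i < n.+1) \sum_(j < n.+1 | (i < j)%N)
    dot (M (embed (u j))) (embed (v i))).
  apply: eq_bigr => i _; rewrite dot_suml; apply: eq_bigr => j _.
  by rewrite dot_embedr.
rewrite (exchange_big_dep xpredT)//=; apply: eq_bigr => j _.
rewrite dot_sumr; apply: eq_bigr => i _.
by rewrite -Msym dot_embedl.
Qed.

Lemma dot_bdiag M (u v : V) :
  dot u (bdiag M v) = \sum_i dot (embed (u i)) (M (embed (v i))).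
Proof. by rewrite hprod_dotE; apply: eq_bigr => i _; rewrite dot_embedl. Qed.

Lemma bdiag_self_adjoint M : self_adjoint M -> self_adjoint (bdiag M).
Proof.
move=> Msym u v; rewrite dot_bdiag [RHS]dotC dot_bdiag.
by apply: eq_bigr => i _; rewrite Msym dotC.
Qed.

Lemma bdiag_pos_semidef M : pos_semidef M -> pos_semidef (bdiag M).
Proof. by move=> M0 u; rewrite dot_bdiag sumr_ge0. Qed.

Lemma bdiag_pos_def M : (forall i, pos_def (fun u : Y i => M (embed u) i)) ->
  pos_def (bdiag M).
Proof.
move=> Mpos u u0; have Mge0 i : 0 <= dot (embed (u i)) (M (embed (u i))).
  have [->|/Mpos/ltW] := eqVneq (u i) 0; last by rewrite dot_embedl.
  by rewrite linear0 dot0l.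
rewrite lt_def dot_bdiag sumr_ge0// andbT; apply: contraNneq u0.
move=> /(psumr_eq0P (fun i _ => Mge0 i)) h; apply/eqP/hprodP => i.
by apply/eqP; apply/negPn/negP => /Mpos; rewrite -dot_embedl h// ltxx.
Qed.

Section sweep.
Context (M : {linear V -> V}) (J : {linear V -> V}).
Hypothesis M_sym : self_adjoint M.
Hypothesis bdiag_pos : pos_def (bdiag M).
Hypothesis JP : forall v, bdiag M (J v) = v.

(** The operator of the block symmetric Gauss-Seidel decomposition: [J] is the
    inverse of the block diagonal, and [lower M] is the adjoint of [upper M]
    when [M] is self-adjoint. *)
Definition sGS_operator : V -> V := upper M \o (J \o lower M).

HB.instance Definition _ := GRing.Linear.on sGS_operator.

Let J_sym : self_adjoint J.
Proof.
by move=> u v; rewrite -{1}(JP u) -(bdiag_self_adjoint M_sym) JP.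
Qed.

Let J_ge0 v : 0 <= dot v (J v).
Proof.
rewrite -{1}(JP v) dotC; have [->|/bdiag_pos/ltW//] := eqVneq (J v) 0.
by rewrite dot0l.
Qed.

Lemma sGS_operator_sym : self_adjoint sGS_operator.
Proof.
move=> u v; rewrite /sGS_operator /= dotC !dot_upper//.
by rewrite -J_sym dotC.
Qed.

Lemma sGS_operator_ge0 : pos_semidef sGS_operator.
Proof. by move=> u; rewrite /sGS_operator /= dotC dot_upper// dotC J_ge0. Qed.

Lemma sGS_operator_eq0 u : dot u (sGS_operator u) = 0 -> lower M u = 0.
Proof.
rewrite /sGS_operator /= dotC dot_upper// -{2}(JP (lower M u)) => h.
have J0 : J (lower M u) = 0.
  by apply/eqP/negPn/negP => /bdiag_pos; rewrite h ltxx.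
by rewrite -(JP (lower M u)) J0 linear0.
Qed.

(** Subtracting the two optimality conditions expresses [dh] through [d] and
    the errors; substituting it in the forward condition leaves one linear step
    in [d], with [sGS_operator] added to [M]. *)
Lemma sGS_sweep (s g d dh delta deltah : V) :
  (forall i : 'I_n.+1, (0 < i)%N -> s i = 0) ->
  (forall i : 'I_n.+1, (0 < i)%N ->
     deltah i = g i + bdiag M dh i + upper M dh i) ->
  deltah ord0 = delta ord0 ->
  (forall i, delta i = s i + g i + lower M d i + bdiag M d i + upper M dh i) ->
  delta + upper M (J (delta - deltah)) = s + g + M d + sGS_operator d.
Proof.
move=> s0 bwd del0 fwd.
(* [upper M dh] does not involve the first block of [dh]; taking it from [d] makes
   the relation between the two passes hold on that block too. *)
pose dh' : V := fun i => if i == ord0 then d i else dh i.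
have up : upper M dh' = upper M dh.
  apply: hprodP => i; apply: eq_bigr => j ij; rewrite /dh'.
  by case: eqVneq => // j0; rewrite j0 in ij.
have bB a b : bdiag M (a - b) = bdiag M a - bdiag M b by exact: linearB.
have uB a b : upper M (a - b) = upper M a - upper M b by exact: linearB.
have dd : bdiag M (d - dh') = delta - deltah - lower M d.
  apply: hprodP => i; rewrite bB !hprodBE.
  have [->|i0] := eqVneq i ord0.
    rewrite del0 [delta ord0 - _]subrr sub0r /lower /block_part big_pred0//.
    by rewrite oppr0 /bdiag /dh' /= subrr.
  have ip : (0 < i)%N by rewrite lt0n.
  rewrite fwd bwd// s0// add0r.
  have -> : bdiag M dh' i = bdiag M dh i by rewrite /bdiag /dh' (negPf i0).
  rewrite {1}/bdiag -/(bdiag M d i).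
  move: (g i) (lower M d i) (bdiag M d i) (bdiag M dh i) (upper M dh i) => *.
  by apply: eq_dot => w; rewrite !dot_expand; ring.
have dhE : dh' = d - J (delta - deltah - lower M d).
  have inj v : bdiag M v = 0 -> v = 0.
    by move=> v0; apply/eqP/negPn/negP => /bdiag_pos; rewrite v0 dot0r ltxx.
  apply/esym/eqP; rewrite -subr_eq0; apply/eqP/inj.
  by rewrite !bB JP -dd bB subKr subrr.
have fwdV : delta = s + g + lower M d + bdiag M d + upper M dh.
  by apply: hprodP => i; rewrite fwd.
rewrite {1}fwdV -up dhE uB [J (_ - lower M d)]linearB uB -/(sGS_operator d).
rewrite [M d]block_split.
rewrite /sGS_operator /=.
move: (lower M d) (bdiag M d) (upper M d) (upper M (J (delta - deltah))) => a b e k.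
move: (upper M (J a)) => m.
by apply: eq_dot => w; rewrite !dot_expand; ring.
Qed.

End sweep.

(** On such a [d] the form of [M] equals that of its block diagonal, the
    off-diagonal part being [2 <d, lower M d>]. With [E = D + Sigma / 2] this
    reads: twice the form of the block diagonal of [E], plus that of [N], is
    zero. Both are nonnegative, so both vanish, and the definiteness of
    [E + N] on the blocks gives [d = 0]. *)
Lemma sGS_kernel (Sigma D N M : {linear V -> V}) d :
  (forall v, M v = Sigma v + D v + N v) ->
  self_adjoint M -> (forall v, bdiag D v = D v) ->
  pos_semidef N -> pos_semidef (fun v => D v + 2^-1 *: Sigma v) ->
  pos_def (bdiag (fun v => D v + 2^-1 *: Sigma v + N v)) ->
  dot d (D d + 2^-1 *: Sigma d) = 0 -> dot d (N d) = 0 -> lower M d = 0 -> d = 0.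
Proof.
move=> ME Msym Ddiag N0 E0 pos Ed Nd ld.
have bdE (T T' T'' : {linear V -> V}) v :
    bdiag (fun u => T u + 2^-1 *: T' u + T'' u) v =
    bdiag T v + 2^-1 *: bdiag T' v + bdiag T'' v by [].
have bdM v : bdiag M v = bdiag Sigma v + bdiag D v + bdiag N v.
  by apply: hprodP => i; rewrite /bdiag ME.
have Md : dot d (M d) = dot d (bdiag M d).
  rewrite {1}block_split ld add0r dotDr [dot d (upper M d)]dotC dot_upper//.
  by rewrite ld dot0r addr0.
have bN := bdiag_pos_semidef N0 d.
have bE : 0 <= dot d (bdiag D d + 2^-1 *: bdiag Sigma d).
  have := @bdiag_pos_semidef (D \+ 2^-1 \*: Sigma) E0 d; by [].
apply/eqP/negPn/negP => /pos; rewrite bdE.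
move: Md bE bN Ed Nd; rewrite bdM ME Ddiag !dot_expand; lra.
Qed.

End block_splitting.

(** * One sweep as an inexact proximal step *)

Section one_sweep.
Context {R : realType} {X Z : hilbertType R} {n : nat}.
Context {Y : 'I_n.+1 -> hilbertType R}.
Local Notation V := (hprod Y).
Context (p : Y ord0 -> \bar R) (f : V -> R).
Context (F : {linear X -> V}) (G : {linear X -> Z}) (b : Z) (c : X).
Context (Sigma : {linear V -> V}) (D : forall i, {linear Y i -> Y i}).
Context (sigma : R).
Hypothesis p_proper : proper_function p.
Hypothesis p_convex : econvex_function p.
Hypothesis Sigma_sym : self_adjoint Sigma.

Lemma Diag_is_linear : linear (Diag D : V -> V).
Proof.
by move=> a u v; apply: hprodP => i; rewrite hprodDE hprodZE /Diag linearP.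
Qed.

HB.instance Definition _ :=
  GRing.isLinear.Build R V V _ (Diag D : V -> V) Diag_is_linear.

Lemma residualD (w e : V) z : residual F G c (w + e) z = residual F G c w z + adj F e.
Proof. by rewrite /residual linearD; apply: eq_dot => v; rewrite !dot_expand; ring. Qed.

(** The augmented Lagrangian without its nonsmooth term [p]. *)
Definition smooth_part (w : V) z x y : R :=
  fhat f Sigma w y - dot b z + dot (residual F G c w z) x
  + sigma / 2 * `|residual F G c w z| ^+ 2.

Definition smooth_grad (w : V) z x y : V :=
  grad f y + Sigma (w - y) + F x + sigma *: F (residual F G c w z).

Lemma smooth_partD w e z x y : smooth_part (w + e) z x y =
  smooth_part w z x y + dot (smooth_grad w z x y) e
  + (2^-1 * dot e (Sigma e) + sigma / 2 * `|adj F e| ^+ 2).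
Proof.
rewrite /smooth_part /smooth_grad /fhat residualD [w + e - y]addrAC.
move: (grad f y) (residual F G c w z) (w - y) => g r d.
rewrite [Sigma (d + e)]linearD -!dotxx !dot_expand -!(adjEr F) (Sigma_sym e d).
rewrite (dotC (Sigma e) d) (Sigma_sym d e).
rewrite (dotC (adj F e) r) (dotC (adj F e) x).
by field.
Qed.

Lemma smooth_part_le : exists C : R, forall w e z x y,
  smooth_part (w + e) z x y <=
  smooth_part w z x y + dot (smooth_grad w z x y) e + C * `|e| ^+ 2.
Proof.
have [C1 C10 S1] := linear_bounded Sigma.
have [C2 C20 S2] := linear_bounded (adj F : {linear V -> X}).
exists (2^-1 * C1 + `|sigma / 2| * C2 ^+ 2) => w e z x y.
rewrite smooth_partD lerD2l mulrDl; apply: lerD.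
  rewrite -mulrA ler_pM2l// (le_trans (dot_le _ _))// expr2 mulrA.
  by rewrite [C1 * _]mulrC -mulrA ler_wpM2l// S1.
rewrite -[leRHS]mulrA -exprMn (le_trans (ler_norm _))// normrM ler_wpM2l//.
rewrite ger0_norm ?sqr_ge0// ler_pXn2r ?nnegrE ?mulr_ge0 ?(ltW C20)//.
exact: S2.
Qed.

Lemma aug_lagrangianE w z x y : aug_lagrangian p f F G b c Sigma sigma w z x y =
  (p (w ord0) + (smooth_part w z x y)%:E)%E.
Proof. by []. Qed.

Lemma first_block_subdiff (u : V) (v : Y ord0) (w : V) z x y g :
  subdiff (fun v' : Y ord0 => aug_lagrangian p f F G b c Sigma sigma (glue u v' w) z x y) v g ->
  subdiff p v (g - smooth_grad (glue u v w) z x y ord0).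
Proof.
have [C SC] := smooth_part_le => h.
apply: (@subdiff_smooth _ _ p (fun v' => smooth_part (glue u v' w) z x y) _ _ _ C) => //.
  move=> v'; rewrite (glue_embed u v v') (le_trans (SC _ _ _ _ _))//.
  by rewrite norm_embed dot_embedr.
suff -> : (fun v' => (p v' + (smooth_part (glue u v' w) z x y)%:E)%E) =
  (fun v' : Y ord0 => aug_lagrangian p f F G b c Sigma sigma (glue u v' w) z x y) by [].
by apply/funext => v'; rewrite aug_lagrangianE glue_in.
Qed.

(** On a block other than the first, [p] is a finite constant: a subgradient of
    a constant plus a smooth function is the gradient of the latter. *)
Lemma other_block_subdiff (i : 'I_n.+1) (u : V) (v : Y i) (w : V) z x y g :
  (0 < i)%N -> p (u ord0) \is a fin_num ->
  subdiff (fun v' : Y i => aug_lagrangian p f F G b c Sigma sigma (glue u v' w) z x y) v g ->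
  g = smooth_grad (glue u v w) z x y i.
Proof.
move=> i0 pfin h; have [C SC] := smooth_part_le.
have pE := esym (fineK pfin); set r := fine _ in pE.
have : subdiff (fun=> r%:E) v (g - smooth_grad (glue u v w) z x y i).
  apply: (@subdiff_smooth _ _ (fun=> r%:E) (fun v' => smooth_part (glue u v' w) z x y) _ _ _ C).
  - by split=> //; exists v.
  - by move=> u' v' t _; rewrite -!EFinM -EFinD lee_fin -mulrDl subrKC mul1r.
  - move=> v'; rewrite (glue_embed u v v') (le_trans (SC _ _ _ _ _))//.
    by rewrite norm_embed dot_embedr.
  suff -> : (fun v' => (r%:E + (smooth_part (glue u v' w) z x y)%:E)%E) =
    (fun v' : Y i => aug_lagrangian p f F G b c Sigma sigma (glue u v' w) z x y) by [].
  apply/funext => v'; rewrite aug_lagrangianE glueE.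
  by rewrite -(inj_eq val_inj) /= gtn_eqF// i0 pE.
move: (smooth_grad _ _ _ _ _) => a hsub.
apply/eqP; rewrite -subr_eq0; apply/eqP/dot_eq0/eqP; rewrite eq_le dot_ge0 andbT.
by have := subdiff_le (v := v + (g - a)) hsub erefl erefl; rewrite addrAC subrr add0r gerDl.
Qed.

Context (M J : {linear V -> V}).
Hypothesis ME : forall v, M v = Sigma v + Diag D v + sigma *: F (adj F v).
Hypothesis bdiag_pos : pos_def (bdiag M).
Hypothesis JP : forall v, bdiag M (J v) = v.

Definition start_grad x (y : V) z : V :=
  grad f y + F x + sigma *: F (residual F G c y z).

(** [D] has no block off the diagonal, so the optimality conditions of all the
    block subproblems are read off the same operator [M]. *)
Lemma smooth_grad_Diag w z x y :
  smooth_grad w z x y + Diag D (w - y) = start_grad x y z + M (w - y).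
Proof.
have -> : smooth_grad w z x y = smooth_grad (y + (w - y)) z x y by rewrite subrKC.
rewrite /smooth_grad /start_grad residualD ME [y + (w - y) - y]addrAC subrr add0r.
move: (grad f y) (residual F G c y z) (w - y) => g r d.
rewrite linearD scalerDr; move: (F (adj F d)) (Diag D d) (Sigma d) (F r) (F x) => *.
by apply: eq_dot => v; rewrite !dot_expand; ring.
Qed.

Lemma sweep_error_bound : exists2 K : R, 0 <= K &
  forall (delta deltah : V) (eps : R),
  (forall i, `|delta i| <= eps) -> (forall i, `|deltah i| <= eps) ->
  `|delta + upper M (J (delta - deltah))| <= K * eps.
Proof.
pose U : {linear V -> V} := upper M \o J.
have [C C0 UC] := linear_bounded U.
exists ((1 + 2 * C) * n.+1%:R); first by rewrite mulr_ge0// addr_ge0// mulr_ge0// ltW.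
move=> delta deltah eps de dhe.
have le_eps (v : V) : (forall i, `|v i| <= eps) -> `|v| <= n.+1%:R * eps.
  move=> h; rewrite (le_trans (norm_hprod_le v))//.
  rewrite (le_trans (ler_sum _ (fun i _ => h i)))// sumr_const card_ord.
  by rewrite mulr_natl.
have d1 := le_eps _ de; have d2 := le_eps _ dhe.
rewrite (le_trans (ler_normD _ _))//.
have := UC (delta - deltah); rewrite /U /= => h.
have : C * `|delta - deltah| <= C * (n.+1%:R * eps + n.+1%:R * eps).
  by rewrite ler_pM2l// (le_trans (ler_normB _ _))// lerD.
move: h d1; lra.
Qed.

(** The first block is in the domain of [p] after the first forward step, as
    the subdifferential is empty elsewhere; this makes the remaining conditions
    equations, to which [sGS_sweep] applies. *)
Lemma sweep_inclusion : exists2 K : R, 0 <= K &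
  forall x (y : V) z (yh y' : V) eps, p (y ord0) \is a fin_num ->
  (forall i : 'I_n.+1, (0 < i)%N -> inexact_argmin
     (fun u => aug_lagrangian p f F G b c Sigma sigma (glue y u yh) z x y)
     (D i) (y i) eps (yh i)) ->
  (forall i : 'I_n.+1, inexact_argmin
     (fun u => aug_lagrangian p f F G b c Sigma sigma (glue y' u yh) z x y)
     (D i) (y i) eps (y' i)) ->
  exists2 e, `|e| <= K * eps & exists2 s, subdiff p (y' ord0) s &
    e = embed s + start_grad x y z + M (y' - y) + sGS_operator M J (y' - y).
Proof.
have [K K0 KP] := sweep_error_bound; exists K => //.
move=> x y z yh y' eps pfin bwd fwd.
have fwd' i : exists u : Y i, `|u| <= eps /\ exists2 g,
    subdiff (fun v => aug_lagrangian p f F G b c Sigma sigma (glue y' v yh) z x y) (y' i) g &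
    u = g + D i (y' i - y i).
  by have [u u_le uP] := fwd i; exists u.
have [delta deltaP] := hprod_choice fwd'.
have [delta_le [g0 g0P d0E]] := deltaP ord0.
pose s := g0 - smooth_grad (glue y' (y' ord0) yh) z x y ord0.
have sP : subdiff p (y' ord0) s by exact: first_block_subdiff g0P.
have pfin' : p (y' ord0) \is a fin_num by exact: subdiff_fin sP.
pose d := y' - y; pose dh := yh - y.
have gradE (u : V) i (v : Y i) : smooth_grad (glue u v yh) z x y i + D i (v - y i) =
    start_grad x y z i + lower M (u - y) i + M (embed (v - y i)) i + upper M dh i.
  have := smooth_grad_Diag (glue u v yh) z x y.
  move=> /(congr1 (fun v : V => v i)); rewrite !hprodDE /Diag hprodBE glue_in => ->.
  by rewrite glueB apply_glue !addrA.
have fwdE i : delta i = embed s i + start_grad x y z i + lower M d i + bdiag M d i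
    + upper M dh i.
  have [i0|i0] := eqVneq i ord0.
    rewrite i0 d0E embedE -[g0](subrK (smooth_grad (glue y' (y' ord0) yh) z x y ord0)).
    by rewrite -/s -addrA gradE !addrA.
  have ip : (0 < i)%N by rewrite lt0n.
  have [_ [g gP ->]] := deltaP i.
  rewrite (other_block_subdiff ip pfin' gP) gradE embed_neq 1?eq_sym//.
  by rewrite add0r.
(* There is no backward step on the first block; the error [delta] there is the
   choice that cancels in [delta - deltah]. *)
have bwd' i : exists u : Y i, `|u| <= eps /\ ((0 < i)%N ->
    u = start_grad x y z i + bdiag M dh i + upper M dh i) /\
    ((i == ord0) -> u = delta i).
  have [->|i0] := eqVneq i ord0; first by exists (delta ord0).
  have ip : (0 < i)%N by rewrite lt0n.
  have [u u_le [g gP uE]] := bwd i ip; exists u; split => //; split => // _.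
  rewrite uE (other_block_subdiff ip pfin gP) gradE subrr.
  by rewrite [lower M 0]linear0 hprod0E addr0.
have [deltah dhP] := hprod_choice bwd'.
exists (delta + upper M (J (delta - deltah))).
  by apply: KP => i; [case: (deltaP i)|case: (dhP i)].
exists s => //; apply: (sGS_sweep bdiag_pos JP (dh := dh)) => //.
- by move=> i ip; rewrite embed_neq// -(inj_eq val_inj) /= ltn_eqF.
- by move=> i ip; have [_ [h _]] := dhP i; exact: h.
- by have [_ [_ h]] := dhP ord0; exact: h.
Qed.

End one_sweep.

(** * Projection on the range of a linear map *)

Section metric_projection.
Context {R : realType} {X Z : hilbertType R}.
Context (G : {linear X -> Z}) (K : {linear X -> Z}).
Hypothesis Kin : forall x, exists u, K x = G u.
Hypothesis KP : forall z, adj G (K (adj G z)) = adj G z.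

(** On the range of [adj G] the map [K] acts as the Moore-Penrose inverse of
    [adj G]; so the projection depends on [adj G z] only, and linearly. *)
Lemma metric_proj_rangeE z : metric_proj (range G) z = K (adj G z).
Proof.
have pyth u : `|z - G u| ^+ 2 = `|z - K (adj G z)| ^+ 2 + `|K (adj G z) - G u| ^+ 2.
  have [v KE] := Kin (adj G z).
  have orth : dot (z - K (adj G z)) (G (v - u)) = 0.
    by rewrite -(adjE G) adjB KP subrr dot0l.
  have -> : z - G u = (z - K (adj G z)) + (K (adj G z) - G u) by rewrite addrA subrK.
  rewrite -!dotxx.
  have -> : K (adj G z) - G u = G (v - u) by rewrite KE linearB.
  move: (z - _) orth => e orth.
  rewrite dotDl !dotDr [dot (G _) e]dotC orth; ring.
have [Pw Pmin] : [set w | range G w /\ forall u, range G u -> `|z - w| <= `|z - u|]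
    (metric_proj (range G) z).
  apply: xgetPex; exists (K (adj G z)); split.
    by have [v ->] := Kin (adj G z); exists v.
  move=> _ [u _ <-]; rewrite -(@ler_pXn2r _ 2)// ?nnegrE// pyth lerDl.
  exact: sqr_ge0.
have [v KE] := Kin (adj G z).
have [u _ uE] := Pw.
have := Pmin (K (adj G z)); rewrite {1}KE => /(_ (ex_intro2 _ _ v I erefl)).
rewrite -(@ler_pXn2r _ 2)// ?nnegrE// -uE pyth gerDl => h.
apply/esym/eqP; rewrite -subr_eq0 -normr_eq0 -sqrf_eq0.
by rewrite eq_le h sqr_ge0.
Qed.

End metric_projection.

(** * KKT points and convex duality *)

Section duality.
Context {R : realType} {X Z : hilbertType R} {n : nat}.
Context {Y : 'I_n.+1 -> hilbertType R}.
Local Notation V := (hprod Y).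
Context (p : Y ord0 -> \bar R) (f : V -> R).
Context (F : {linear X -> V}) (G : {linear X -> Z}) (b : Z) (c : X).
Hypothesis p_proper : proper_function p.
Hypothesis f_convex : convex_function [set: V] f.
Hypothesis f_diff : forall y, differentiable f y.
Context (x : X) (y : V) (z : Z).
Hypothesis kkt : KKT p f F G b c x y z.

Lemma KKT_feasible : residual F G c y z = 0.
Proof. by case: kkt => _ _ E; rewrite /residual E subrr. Qed.

Lemma KKT_fin : p (y ord0) \is a fin_num.
Proof. by case: kkt => -[g gP _] _ _; exact: subdiff_fin gP. Qed.

Lemma objective_fin : objective p f b y z \is a fin_num.
Proof. by rewrite /objective fin_numD KKT_fin. Qed.

(** The convexity inequalities of [p] and [f] at [y]; stationarity in [y] and
    [z] cancels their linear terms against the multiplier term. *)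
Lemma KKT_saddle (w : V * Z) : (objective p f b y z <=
  objective p f b w.1 w.2 + (dot x (residual F G c w.1 w.2))%:E)%E.
Proof.
case: kkt => -[g gP stat] /eqP; rewrite subr_eq0 => /eqP Gx feas.
case: w => w v /=; rewrite /objective.
have yE := esym (fineK KKT_fin).
have [wy|wy] := eqVneq (p (w ord0)) +oo%E; first by rewrite wy addye// leey.
have [r wE] : exists r, p (w ord0) = r%:E.
  by have := p_proper.1 (w ord0); case: (p (w ord0)) wy => // r; exists r.
have := subdiff_le gP yE wE; rewrite yE wE -!EFinD lee_fin.
have := convex_gradient f_convex (f_diff y) w.
have : dot (embed g + grad f y + F x) (w - y) = 0 by rewrite stat dot0l.
have -> : residual F G c w v = adj F (w - y) + adj G (v - z).
  rewrite /residual -feas !adjB; move: (adj F w) (adj F y) (adj G v) (adj G z) => *.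
  by apply: eq_dot => ?; rewrite !dot_expand; ring.
rewrite [dot x _]dotDr !adjEr Gx (dotDl _ (F x)) (dotDl _ (grad f y)) dot_embedl.
rewrite hprodBE [dot b (v - z)]dotDr dotNr.
lra.
Qed.

Lemma KKT_primal_solution : primal_solution p f F G b c y z.
Proof.
split; [exact: KKT_feasible | exact: objective_fin |].
by move=> w wf; have := KKT_saddle w; rewrite wf dot0r adde0.
Qed.

Lemma KKT_optimal_value : optimal_value p f F G b c = objective p f b y z.
Proof.
apply/eqP; rewrite eq_le; apply/andP; split.
  by apply: ereal_inf_lbound; exists (y, z) => //; exact: KKT_feasible.
apply: le_ereal_inf_tmp => _ [w wf <-].
by have [_ _] := KKT_primal_solution; apply.
Qed.

Lemma dual_function_le x' : (dual_function p f F G b c x' <= objective p f b y z)%E.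
Proof.
apply: ereal_inf_lbound; exists (y, z) => //=.
by rewrite KKT_feasible dot0r adde0.
Qed.

Lemma KKT_dual_function : dual_function p f F G b c x = objective p f b y z.
Proof.
apply/eqP; rewrite eq_le dual_function_le; apply: le_ereal_inf_tmp => _ [w _ <-].
exact: KKT_saddle.
Qed.

Lemma KKT_dual_solution : dual_solution p f F G b c x.
Proof.
split; first by rewrite KKT_dual_function objective_fin.
by move=> x'; rewrite KKT_dual_function dual_function_le.
Qed.

End duality.

(** * Elimination of z *)

Section reduction.
Context {R : realType} {X Z : hilbertType R} {n : nat}.
Context {Y : 'I_n.+1 -> hilbertType R}.
Local Notation V := (hprod Y).
Context (p : Y ord0 -> \bar R) (f : V -> R).
Context (F : {linear X -> V}) (G : {linear X -> Z}) (b : Z) (c : X).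
Context (Sigma : {linear V -> V}) (D : forall i, {linear Y i -> Y i}).
Context (sigma tau : R) (K : {linear Z -> X}).
Hypothesis Kin : forall z, exists z', K z = adj G z'.
Hypothesis GK : forall x, G (K (G x)) = G x.
Hypothesis KG : forall z, K (G (adj G z)) = adj G z.
Hypothesis KG_sym : forall u v, dot (K (G u)) v = dot u (K (G v)).
Hypothesis range_b : G (K b) = b.

(** [F] on the kernel of [G], extended by 0 on its orthogonal complement. *)
Definition F_ker : {linear X -> V} := F \- (F \o (K \o G)).

Definition c_ker : X := c - K (G c).

(** The constraint [G x = b] fixes the component [K b] of the multiplier in the
    range of [adj G]; its action on [y] is a constant. *)
Definition h_ker (y : V) : V := grad f y + F (K b).

Definition subdiff_first (y g : V) : Prop :=
  exists2 s, subdiff p (y ord0) s & g = embed s.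

Lemma F_kerE x : F_ker x = F x - F (K (G x)). Proof. by []. Qed.

Lemma adj_F_ker y : adj F_ker y = adj F y - K (G (adj F y)).
Proof.
apply: eq_dot => w; rewrite adjE F_kerE !dot_expand KG_sym.
by rewrite -!(adjE F).
Qed.

Lemma F_ker_fix x : G x = 0 -> F_ker x = F x.
Proof. by move=> Gx; rewrite F_kerE Gx [K 0]linear0 [F 0]linear0 subr0. Qed.

Lemma G_sub_proj x : G (x - K (G x)) = 0.
Proof. by rewrite [G (x - _)]linearB GK subrr. Qed.

Lemma KKT_inclusion x y z : KKT p f F G b c x y z ->
  inclusion_solution F_ker c_ker h_ker subdiff_first (x - K (G x)) y.
Proof.
move=> [[g gP stat] /eqP]; rewrite subr_eq0 => /eqP Gx feas; split.
  exists g => //; rewrite F_ker_fix ?G_sub_proj// /h_ker Gx [F (x - _)]linearB.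
  move: stat; move: (embed g) (grad f y) (F x) (F (K b)) => e gr a a' /eqP.
  rewrite -addrA addr_eq0 => /eqP ->.
  by apply: eq_dot => w; rewrite !dot_expand; ring.
rewrite adj_F_ker /c_ker -feas [G (adj F y + _)]linearD [K (G _ + _)]linearD KG.
move: (K (G (adj F y))) (adj F y) (adj G z) => *.
by apply: eq_dot => w; rewrite !dot_expand; ring.
Qed.

Lemma inclusion_KKT u y z :
  inclusion_solution F_ker c_ker h_ker subdiff_first u y -> G u = 0 ->
  adj G z = c - adj F y -> KKT p f F G b c (u + K b) y z.
Proof.
move=> [[g gP gE] _] Gu Gz; split.
- exists g => //; rewrite -gE /h_ker F_ker_fix// [F (u + _)]linearD.
  move: (grad f y) (F u) (F (K b)) => *.
  by apply: eq_dot => w; rewrite !dot_expand; ring.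
- by rewrite [G (u + _)]linearD Gu add0r range_b subrr.
- by rewrite Gz subrKC.
Qed.

Context (M J : {linear V -> V}).
Hypothesis ME : forall v, M v = Sigma v + Diag D v + sigma *: F (adj F v).
Hypothesis JP : forall v, bdiag M (J v) = v.

(** The last term is the part of [sigma F (adj F)] that is left in the proximal
    term because the reduced constraint is blind to it. *)
Definition T_ker : {linear V -> V} :=
  (Diag D \+ sGS_operator M J) \+ (sigma \*: (F \o (K \o (G \o adj F)))).

Lemma T_kerE v :
  T_ker v = Diag D v + sGS_operator M J v + sigma *: F (K (G (adj F v))).
Proof. by []. Qed.

(** The reduced step differs from the sweep by the image under [F K] of
    [G x - b + sigma G r], which would vanish if [z] were the exact minimizer
    for the current [x] and [y]. *)
Lemma reduced_step (x : X) (y : V) (z : Z) (x' : X) (y' : V) (z' : Z) (e : V) s :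
  subdiff p (y' ord0) s ->
  e = embed s + start_grad f F G c sigma x y z + M (y' - y)
      + sGS_operator M J (y' - y) ->
  x' = x + (tau * sigma) *: residual F G c y' z' ->
  proximal_ALM_step F_ker c_ker h_ker subdiff_first Sigma T_ker sigma tau
    (x - K (G x)) y
    (e - F (K (G x - b + sigma *: G (residual F G c y z))))
    (x' - K (G x')) y'.
Proof.
move=> sP eE x'E.
have GcK v : G (adj F v - K (G (adj F v)) - (c - K (G c))) = 0.
  by rewrite [G (_ - _ - (_ - _))]linearB !G_sub_proj subrr.
have KG_dot v w : dot (adj G v) (adj G (adj K w)) = dot (adj G v) w.
  by rewrite !adjEr KG.
split.
  exists s => //; rewrite adj_F_ker /c_ker F_ker_fix; last first.
    by rewrite [G (_ + _ *: _)]linearD [G (_ *: _)]linearZ /= GcK scaler0 addr0 G_sub_proj.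
  rewrite eE ME T_kerE /start_grad /h_ker /residual.
  have -> : adj F y' = adj F y + adj F (y' - y) by rewrite -adjD subrKC.
  move: (y' - y) (adj F y) => d Fy.
  move: (grad f y) (Sigma d) (Diag D d) (sGS_operator M J d) (embed s) (adj F d).
  move=> g Sd Dd Bd es Fd.
  apply: eq_dot => w; rewrite !dot_expand -!(adjEr F); move: (adj F w) => v.
  rewrite !dot_expand -!(adjEr K); move: (adj K v) (KG_dot z v) => a.
  rewrite !dot_expand -!(adjEr G) !dot_expand => ->.
  by move: (adj G a) => a'; ring.
rewrite x'E adj_F_ker /c_ker /residual; move: (adj F y') => Fy.
apply: eq_dot => w; rewrite !dot_expand -!(adjEr K) -!(adjEr G) !dot_expand.
by rewrite KG_dot; ring.
Qed.

(** * The proximal operator of the reduced method *)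

Hypothesis Sigma_sym : self_adjoint Sigma.
Hypothesis Sigma_ge0 : pos_semidef Sigma.
Hypothesis sigma_gt0 : 0 < sigma.
Hypothesis D_sym : forall i, self_adjoint (D i).
Hypothesis D_block : forall i, pos_def (fun u : Y i =>
  2^-1 *: block Sigma i u + sigma *: op_comp i F (adj (op_comp i F) u) + D i u).
Hypothesis D_diag : pos_semidef (fun u : V => Diag D u + 2^-1 *: Sigma u).

Lemma Diag_sym : self_adjoint (Diag D : V -> V).
Proof. by move=> u v; rewrite !hprod_dotE; apply: eq_bigr => i _; exact: D_sym. Qed.

Lemma Diag_embed i (u : Y i) : Diag D (embed u) = embed (D i u).
Proof.
apply: hprodP => j; rewrite /Diag.
have [<-|ij] := eqVneq i j; first by rewrite !embedE.
by rewrite !embed_neq// linear0.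
Qed.

Lemma M_sym : self_adjoint M.
Proof.
move=> u v; rewrite !ME !dot_expand Sigma_sym Diag_sym.
by rewrite -(adjE F) -(adjEr F).
Qed.

Lemma adj_op_comp i (u : Y i) : adj (op_comp i F) u = adj F (embed u).
Proof.
by congr riesz; apply/funext => v; rewrite dot_embedl.
Qed.

Definition half_M : {linear V -> V} :=
  (Diag D \+ 2^-1 \*: Sigma) \+ (sigma \*: (F \o adj F)).

Lemma half_M_block i (u : Y i) : half_M (embed u) i =
  2^-1 *: block Sigma i u + sigma *: op_comp i F (adj (op_comp i F) u) + D i u.
Proof.
rewrite /half_M /= !hprodDE !hprodZE Diag_embed embedE adj_op_comp /block /op_comp.
by rewrite -addrA addrC.
Qed.

Lemma bdiag_half_M_pos : pos_def (bdiag half_M).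
Proof. by apply: bdiag_pos_def => i u /D_block; rewrite half_M_block. Qed.

Lemma bdiag_M_pos : pos_def (bdiag M).
Proof.
move=> u /bdiag_half_M_pos; have := bdiag_pos_semidef Sigma_ge0 u.
have -> : bdiag M u = bdiag half_M u + 2^-1 *: bdiag Sigma u.
  apply: hprodP => i; rewrite hprodDE hprodZE /bdiag ME /half_M /= !hprodDE !hprodZE.
  move: (Sigma _ i) (Diag D _ i) (F _ i) => *.
  by apply: eq_dot => w; rewrite !dot_expand; field.
move=> S0 h; rewrite [dot u (_ + _)]dotDr dotZr; lra.
Qed.

Let J_op_sym := sGS_operator_sym M_sym JP.
Let J_op_ge0 := sGS_operator_ge0 M_sym bdiag_M_pos JP.

Lemma proj_dot w : dot w (K (G w)) = `|K (G w)| ^+ 2.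
Proof. by rewrite -dotxx KG_sym GK. Qed.

Lemma proj_pythagoras w : `|w| ^+ 2 = `|K (G w)| ^+ 2 + `|w - K (G w)| ^+ 2.
Proof.
have := proj_dot w; rewrite -!dotxx !dot_expand (dotC (K _) w); lra.
Qed.

Lemma T_ker_sym : self_adjoint T_ker.
Proof.
move=> u v; rewrite !T_kerE !dot_expand Diag_sym J_op_sym -(adjE F) -(adjEr F).
by rewrite KG_sym.
Qed.

Lemma T_ker_form v : dot v (T_ker v) = dot v (Diag D v) +
  dot v (sGS_operator M J v) + sigma * `|K (G (adj F v))| ^+ 2.
Proof. by rewrite T_kerE !dot_expand -(adjE F) proj_dot. Qed.

Lemma T_ker_ge : pos_semidef (fun v => T_ker v + 2^-1 *: Sigma v).
Proof.
move=> v; rewrite dotDr T_ker_form dotZr.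
have := D_diag v; rewrite dotDr dotZr; have := J_op_ge0 v.
have : 0 <= sigma * `|K (G (adj F v))| ^+ 2 by rewrite mulr_ge0 ?sqr_ge0// ltW.
lra.
Qed.

(** By Pythagoras, the last term of [T_ker] and [F_ker (adj F_ker)] add up to
    the whole of [F (adj F)], as [sGS_kernel] requires. *)
Lemma T_ker_pos :
  pos_def (fun v => T_ker v + 2^-1 *: Sigma v + sigma *: F_ker (adj F_ker v)).
Proof.
move=> v v0; rewrite dotDr dotDr T_ker_form !dotZr -(adjE F_ker) adj_F_ker dotxx.
have := D_diag v; rewrite dotDr dotZr; have := J_op_ge0 v.
have := proj_pythagoras (adj F v).
set a := `|K _| ^+ 2; set e := `|_ - _| ^+ 2.
have a0 : 0 <= sigma * a by rewrite mulr_ge0 ?sqr_ge0// ltW.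
have e0 : 0 <= sigma * e by rewrite mulr_ge0 ?sqr_ge0// ltW.
move=> pyth B0 E0.
rewrite lt_def; apply/andP; split; last by lra.
apply: contra_neq v0 => tot.
have lower0 : lower M v = 0.
  by apply: (sGS_operator_eq0 M_sym bdiag_M_pos JP); lra.
have N0 : pos_semidef (sigma \*: (F \o adj F)).
  by move=> u; rewrite /= dotZr -(adjE F) dotxx mulr_ge0 ?sqr_ge0// ltW.
apply: (@sGS_kernel _ _ _ Sigma (Diag D) (sigma \*: (F \o adj F)) M) => //.
- exact: M_sym.
- move=> u; apply: hprodP => i; transitivity (Diag D (embed (u i)) i) => //.
  by rewrite Diag_embed embedE.
- exact: bdiag_half_M_pos.
- by rewrite dotDr dotZr; lra.
- by rewrite /= dotZr -(adjE F) dotxx pyth mulrDr; lra.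
Qed.

(** * Convergence of the iterates *)

Hypothesis p_proper : proper_function p.
Hypothesis p_convex : econvex_function p.
Hypothesis p_closed : lower_semicontinuous p.
Hypothesis f_convex : convex_function [set: V] f.
Hypothesis f_diff : forall y, differentiable f y.
Hypothesis f_grad_continuous : continuous (grad f).
Hypothesis f_majorized : forall y y', f y <= fhat f Sigma y y'.
Hypotheses (tau_gt0 : 0 < tau) (tau_lt2 : tau < 2).

Lemma subdiff_first_monotone : monotone_relation subdiff_first.
Proof.
move=> y _ y' _ [g gP ->] [g' g'P ->].
have -> : embed g - embed g' = embed (g - g') by rewrite linearB.
by rewrite dot_embedl hprodBE; exact: subdiff_monotone gP g'P.
Qed.

Lemma subdiff_first_closed : closed_relation subdiff_first.
Proof.
move=> y g ys gs yg cy cg.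
have yg' k : exists s, subdiff p (y k ord0) s /\ g k = embed s.
  by have [s] := yg k; exists s.
have [s sP] := choice yg'.
have sE : s = hcoord ord0 \o g.
  by apply/funext => k; rewrite /= (sP k).2 /hcoord embedE.
have coord_cvg i (v : nat -> V) (l : V) : v @ \oo --> l -> (hcoord i \o v) @ \oo --> l i.
  exact: (linear_cvg (hcoord i : {linear V -> Y i})).
exists (gs ord0).
  apply: (subdiff_closed p_proper p_closed (fun k => (sP k).1)).
    exact: (coord_cvg ord0 _ _ cy).
  by rewrite sE; exact: (coord_cvg ord0 _ _ cg).
apply: hprodP => i; have [<-|i0] := eqVneq ord0 i; first by rewrite embedE.
rewrite embed_neq//; apply: (cvg_unique _ (coord_cvg i _ _ cg)) => //=.
have -> : hcoord i \o g = fun=> 0.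
  by apply/funext => k; rewrite /= (sP k).2 /hcoord embed_neq.
exact: cvg_cst.
Qed.

Lemma h_ker_continuous : continuous h_ker.
Proof. exact: continuous_addr f_grad_continuous. Qed.

Lemma h_ker_quarter y' yb y :
  - (4^-1 * dot (y - y') (Sigma (y - y'))) <= dot (h_ker y' - h_ker yb) (y - yb).
Proof.
have -> : h_ker y' - h_ker yb = grad f y' - grad f yb.
  rewrite /h_ker; move: (grad f y') (grad f yb) (F (K b)) => u v w.
  by rewrite opprD addrACA subrr addr0.
exact: gradient_quarter.
Qed.

Section iterates.
Context (eps : nat -> R) (x : nat -> X) (y yh : nat -> V) (z : nat -> Z).
Hypothesis eps_ge0 : forall k, 0 <= eps k.
Hypothesis eps_summable : cvgn (series eps).
Hypothesis y0_dom : edom p (y 0%N ord0).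
Hypothesis backward : forall k (i : 'I_n.+1), (0 < i)%N -> inexact_argmin
  (fun u => aug_lagrangian p f F G b c Sigma sigma (glue (y k) u (yh k)) (z k) (x k) (y k))
  (D i) (y k i) (eps k) (yh k i).
Hypothesis forward : forall k (i : 'I_n.+1), inexact_argmin
  (fun u => aug_lagrangian p f F G b c Sigma sigma (glue (y k.+1) u (yh k)) (z k) (x k) (y k))
  (D i) (y k i) (eps k) (y k.+1 i).
Hypothesis z_step : forall k,
  `|G (x k) - b + sigma *: G (residual F G c (y k.+1) (z k.+1))| <= eps k.
Hypothesis x_step : forall k,
  x k.+1 = x k + (tau * sigma) *: residual F G c (y k.+1) (z k.+1).

Let res k := residual F G c (y k) (z k).

Lemma dual_residual_step k : G (x k.+1) - b = (1 - tau) *: (G (x k) - b)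
  + tau *: (G (x k) - b + sigma *: G (res k.+1)).
Proof.
rewrite x_step [G (_ + _)]linearD [G (_ *: _)]linearZ /=.
by move: (G (x k)) (G _) => *; apply: eq_dot => w; rewrite !dot_expand; ring.
Qed.

(** [G x - b] is multiplied by [1 - tau] at each step, up to a summable error,
    and [|1 - tau| < 1]. *)
Lemma dual_residual_summable : cvgn (series (fun k => `|G (x k) - b|)).
Proof.
apply: (@summable_contraction _ _ (fun k => tau * eps k) `|1 - tau|) => //.
- by rewrite normr_ge0 /= norm_onem_lt1.
- by move=> k; rewrite mulr_ge0// ltW.
- move=> k; rewrite dual_residual_step (le_trans (ler_normD _ _))//.
  by rewrite !normrZ lerD2l (gtr0_norm tau_gt0) ler_pM2l// z_step.
- exact: cvg_series_scale.
Qed.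

Lemma range_residual_summable : cvgn (series (fun k => sigma * `|G (res k)|)).
Proof.
apply/summable_shift; first by move=> k; rewrite mulr_ge0// ltW.
apply: (@summable_le _ _ (fun k => `|G (x k) - b| + eps k)).
- by move=> k; rewrite mulr_ge0// ltW.
- move=> k; set a := G (x k) - b; set v := G (res k.+1).
  have -> : sigma * `|v| = `|(a + sigma *: v) - a|.
    by rewrite addrAC subrr add0r normrZ gtr0_norm.
  by rewrite (le_trans (ler_normB _ _))// [leLHS]addrC lerD2l z_step.
- exact: (cvg_series_add dual_residual_summable eps_summable).
Qed.

Lemma iterates_inclusion : exists delta : nat -> V,
  cvgn (series (fun k => `|delta k|)) /\
  forall k, proximal_ALM_step F_ker c_ker h_ker subdiff_first Sigma T_ker sigma tau
    (x k - K (G (x k))) (y k) (delta k) (x k.+1 - K (G (x k.+1))) (y k.+1).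
Proof.
have [C C0 sweep] := sweep_inclusion f G b c p_proper p_convex Sigma_sym ME
  bdiag_M_pos JP.
have step k (pfin : p (y k ord0) \is a fin_num) :=
  sweep (x k) (y k) (z k) (yh k) (y k.+1) (eps k) pfin (backward k) (forward k).
have y_fin k : p (y k ord0) \is a fin_num.
  elim: k => [|k IH].
    have := p_proper.1 (y 0%N ord0); move: y0_dom; rewrite /edom /=.
    by case: (p _).
  by have [_ _ [s sP _]] := step k IH; exact: subdiff_fin sP.
pose err k := G (x k) - b + sigma *: G (res k).
have ex k : exists e, `|e| <= C * eps k /\ proximal_ALM_step F_ker c_ker h_ker
    subdiff_first Sigma T_ker sigma tau (x k - K (G (x k))) (y k) (e - F (K (err k)))
    (x k.+1 - K (G (x k.+1))) (y k.+1).
  have [e e_le [s sP eE]] := step k (y_fin k); exists e; split => //.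
  exact: reduced_step sP eE (x_step k).
have [e eP] := choice ex.
have [C' C'0 FK_le] := linear_bounded (F \o K : {linear Z -> V}).
exists (fun k => e k - F (K (err k))); split => [|k]; last by case: (eP k).
apply: (@summable_le _ _ (fun k => C * eps k +
    C' * (`|G (x k) - b| + sigma * `|G (res k)|))) => // [k|].
  rewrite (le_trans (ler_normB _ _))// lerD//; first by case: (eP k).
  rewrite (le_trans (FK_le _))// ler_pM2l// (le_trans (ler_normD _ _))//.
  by rewrite normrZ gtr0_norm.
apply: cvg_series_add; first exact: cvg_series_scale.
apply: cvg_series_scale; apply: cvg_series_add.
  exact: dual_residual_summable.
exact: range_residual_summable.
Qed.

(** The limit of [z] itself need not exist. What determines it modulo the kernel
    of [adj G] is the limit of [adj G (z k)], and every [zs] compatible with it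
    completes the KKT point. *)
Lemma iterates_converge : KKT_set p f F G b c !=set0 ->
  exists xs ys, [/\ x @ \oo --> xs, y @ \oo --> ys,
    (fun k => adj G (z k)) @ \oo --> c - adj F ys, res @ \oo --> (0 : X) &
    [/\ (fun k => fine (p (y k ord0))) @ \oo --> (fine (p (ys ord0)) : R),
      forall k, p (y k.+1 ord0) \is a fin_num,
      exists zs, adj G zs = c - adj F ys &
      forall zs, adj G zs = c - adj F ys -> KKT p f F G b c xs ys zs]].
Proof.
move=> [[[x0 y0] z0] /= kkt0].
have [delta [delta_sum steps]] := iterates_inclusion.
have sol0 : exists ub yb, inclusion_solution F_ker c_ker h_ker subdiff_first ub yb.
  by exists (x0 - K (G x0)), y0; exact: KKT_inclusion kkt0.
have [us [ys [sol u_cvg y_cvg]]] := proximal_ALM_converges Sigma_sym Sigma_ge0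
  T_ker_sym T_ker_ge T_ker_pos sigma_gt0 tau_gt0 tau_lt2 h_ker_continuous
  h_ker_quarter subdiff_first_monotone subdiff_first_closed steps delta_sum sol0.
have Gus : G us = 0.
  apply: (cvg_unique _ (linear_cvg G u_cvg)) => //=.
  have -> : G \o (fun k => x k - K (G (x k))) = fun=> 0.
    by apply/funext => k; rewrite /= G_sub_proj.
  exact: cvg_cst.
have Gx_cvg := norm_cvg0_summable dual_residual_summable.
have x_cvg : x @ \oo --> us + K b.
  have -> : x = fun k => (x k - K (G (x k))) + (K (G (x k) - b) + K b).
    by apply/funext => k; rewrite linearB subrK subrK.
  apply: cvgD => //; rewrite -[X in _ --> X](add0r (K b)).
  apply: cvgD; last exact: cvg_cst.
  by rewrite -[X in _ --> X](linear0 K); exact: linear_cvg Gx_cvg.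
have Gr_cvg : (fun k => G (res k)) @ \oo --> (0 : Z).
  apply: norm_cvg0_summable.
  have := @cvg_series_scale _ sigma^-1 _ range_residual_summable.
  by under eq_fun do rewrite mulrA mulVf ?mul1r ?gt_eqF//.
have adjF_cvg := linear_cvg (adj F_ker : {linear V -> X}) y_cvg.
have r_cvg : res @ \oo --> (0 : X).
  have -> : res = fun k => K (G (res k)) + (adj F_ker (y k) - c_ker).
    apply/funext => k; rewrite adj_F_ker /c_ker /res /residual.
    rewrite [G (_ - c)]linearB [G (_ + adj G _)]linearD.
    rewrite [K (_ - G c)]linearB [K (_ + G (adj G _))]linearD KG.
    move: (K (G (adj F (y k)))) (adj F (y k)) (adj G (z k)) (K (G c)) => *.
    by apply: eq_dot => w; rewrite !dot_expand; ring.
  rewrite -[X in _ --> X](addr0 0); apply: cvgD.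
    by rewrite -[X in _ --> X](linear0 K); exact: linear_cvg Gr_cvg.
  rewrite -[X in _ --> X](subrr c_ker) -[X in _ --> X - _](sol.2).
  by apply: cvgB => //; exact: cvg_cst.
have Gz_cvg : (fun k => adj G (z k)) @ \oo --> c - adj F ys.
  have -> : (fun k => adj G (z k)) = fun k => res k + (c - adj F (y k)).
    apply/funext => k; rewrite /res /residual.
    move: (adj F (y k)) (adj G (z k)) => *.
    by apply: eq_dot => w; rewrite !dot_expand; ring.
  rewrite -[X in _ --> X]add0r; apply: cvgD => //.
  apply: cvgB; first exact: cvg_cst.
  exact: (linear_cvg (adj F : {linear V -> X}) y_cvg).
have [zs zsE] : exists zs, adj G zs = c - adj F ys.
  have [zs zsE] := Kin (G (c - adj F ys)); exists zs; rewrite -zsE.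
  apply: (cvg_unique _ _ Gz_cvg) => //=.
  have -> : (fun k => adj G (z k)) = (K \o G) \o (fun k => adj G (z k)).
    by apply/funext => k; rewrite /= KG.
  exact: (linear_cvg (K \o G : {linear X -> X}) Gz_cvg).
have ySs : (fun k => y k.+1) @ \oo --> ys by rewrite cvg_shiftS.
have dir := step_direction_cvg Sigma T_ker sigma h_ker_continuous u_cvg y_cvg ySs
  (norm_cvg0_summable delta_sum) sol.2.
have ex_s k : exists s, subdiff p (y k.+1 ord0) s /\
    delta k - h_ker (y k) - F_ker (x k - K (G (x k))
    + sigma *: (adj F_ker (y k.+1) - c_ker))
    - (Sigma (y k.+1 - y k) + T_ker (y k.+1 - y k)) = embed s.
  by have [[s sP sE] _] := steps k; exists s.
have [s sP] := choice ex_s.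
have coord_cvg (v : nat -> V) (l : V) : v @ \oo --> l -> (fun k => v k ord0) @ \oo --> l ord0.
  exact: (linear_cvg (hcoord ord0 : {linear V -> Y ord0})).
have s_cvg : s @ \oo --> (- (h_ker ys + F_ker us)) ord0.
  have -> : s = fun k => embed (s k) ord0 by apply/funext => k; rewrite embedE.
  apply: (coord_cvg (fun k => embed (s k)) (- (h_ker ys + F_ker us))).
  by move: dir; under eq_fun do rewrite (sP _).2.
exists (us + K b), ys; split => //; split.
- rewrite -cvg_shiftS; apply: (subdiff_value_cvg p_proper p_closed (fun k => (sP k).1)).
    exact: coord_cvg ySs.
  exact: s_cvg.
- by move=> k; exact: subdiff_fin (sP k).1.
- by exists zs.
- by move=> z' z'E; exact: inclusion_KKT.
Qed.

End iterates.

End reduction.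

(** * The convergence theorem *)

Theorem theorem4p2 (R : realType) (X Z : hilbertType R)
  (n : nat) (Y : 'I_n.+1 -> hilbertType R)
  (p : Y ord0 -> \bar R) (f : hprod Y -> R)
  (F : {linear X -> hprod Y}) (G : {linear X -> Z}) (b : Z) (c : X)
  (p_proper : proper_function p) (p_convex : econvex_function p)
  (p_closed : lower_semicontinuous p)
  (f_convex : convex_function [set: hprod Y] f)
  (f_differentiable : forall y, differentiable f y)
  (f_grad_continuous : continuous (grad f))
  (f_grad_lipschitz : exists l : R, l.-lipschitz (grad f))
  (Sigma : {linear hprod Y -> hprod Y})
  (Sigma_self_adjoint : self_adjoint Sigma) (Sigma_pos_semidef : pos_semidef Sigma)
  (f_majorized : forall y y', f y <= fhat f Sigma y y')
  (sigma tau : R) (sigma_gt0 : 0 < sigma) (tau_gt0 : 0 < tau) (tau_lt2 : tau < 2)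
  (eps : nat -> R) (eps_ge0 : forall k, 0 <= eps k) (eps_summable : cvgn (series eps))
  (D : forall i, {linear Y i -> Y i})
  (D_self_adjoint : forall i, self_adjoint (D i))
  (KKT_nonempty : KKT_set p f F G b c !=set0)
  (D_block : forall i, pos_def (fun u : Y i =>
     2^-1 *: block Sigma i u + sigma *: op_comp i F (adj (op_comp i F) u) + D i u))
  (D_diag : pos_semidef (fun u : hprod Y => Diag D u + 2^-1 *: Sigma u))
  (x : nat -> X) (y : nat -> hprod Y) (z : nat -> Z)
  (xyz_generated : generated_by_sGS_iPADMM p f F G b c Sigma D sigma tau eps x y z) :
  [/\ (exists ybar zbar, primal_solution p f F G b c ybar zbar /\
         (fun k => (y k, metric_proj (range G) (z k))) @ \oo --> (ybar, zbar)) /\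
      (exists xbar, dual_solution p f F G b c xbar /\ x @ \oo --> xbar),
      forall ybar zbar, cluster ((fun k => (y k, z k)) @ \oo) (ybar, zbar) ->
        primal_solution p f F G b c ybar zbar,
      (fun k => objective p f b (y k) (z k)) @ \oo
        --> optimal_value p f F G b c /\
      (fun k => residual F G c (y k) (z k)) @ \oo --> (0 : X),
      (fun k => dist_to (x k, y k, z k) (KKT_set p f F G b c)) @ \oo --> (0 : R) &
      (forall v : Z, exists u : X, G u = v) ->
        exists xbar ybar zbar, KKT p f F G b c xbar ybar zbar /\
          (fun k => (x k, y k, z k)) @ \oo --> (xbar, ybar, zbar)].
Proof.
have [y0_dom [yh gen]] := xyz_generated.
have [K [Kin GK KG KG_sym]] := moore_penrose G.
have [K' [K'in GK' _ _]] := moore_penrose (adj G : {linear Z -> X}).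
have K'_range u : exists v, K' u = G v.
  by have [v ->] := K'in u; exists v; rewrite adjK.
have range_b : G (K b) = b.
  have [[[x1 y1] z1] [_ /eqP + _]] := KKT_nonempty.
  by rewrite subr_eq0 => /eqP <-; exact: GK.
pose M : {linear hprod Y -> hprod Y} := (Sigma \+ Diag D) \+ (sigma \*: (F \o adj F)).
have ME v : M v = Sigma v + Diag D v + sigma *: F (adj F v) by [].
have [J JP] := pos_def_inverse (bdiag_M_pos ME Sigma_pos_semidef D_block).
have [xs [ys [x_cvg y_cvg Gz_cvg r_cvg [p_cvg p_fin [z1 z1E] kkt]]]] :=
  iterates_converge Kin GK KG KG_sym range_b ME JP Sigma_self_adjoint
    Sigma_pos_semidef sigma_gt0 D_self_adjoint D_block D_diag p_proper p_convex
    p_closed f_convex f_differentiable f_grad_continuous f_majorized tau_gt0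
    tau_lt2 eps_ge0 eps_summable y0_dom
    (fun k => let: And4 h _ _ _ := gen k in h)
    (fun k => let: And4 _ h _ _ := gen k in h)
    (fun k => let: And4 _ _ h _ := gen k in h)
    (fun k => let: And4 _ _ _ h := gen k in h) KKT_nonempty.
pose zs := K' (c - adj F ys).
have zsE : adj G zs = c - adj F ys by rewrite /zs -z1E GK'.
have kkts := kkt zs zsE.
have projE := metric_proj_rangeE K'_range GK'.
have proj_cvg : (fun k => metric_proj (range G) (z k)) @ \oo --> zs.
  by under eq_fun do rewrite projE; exact: linear_cvg Gz_cvg.
split.
- split.
    exists ys, zs; split; first exact: KKT_primal_solution kkts.
    exact: (cvg_pair y_cvg proj_cvg).
  by exists xs; split => //; exact: KKT_dual_solution kkts.
- move=> ybar zbar /cluster_subsequence[s [sP cs]].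
  have ybarE : ybar = ys.
    apply: (cvg_unique _ _ (cvg_along sP y_cvg)) => //=.
    exact: (cvg_comp _ _ cs cvg_fst).
  have z_cvg : (z \o s) @ \oo --> zbar by exact: (cvg_comp _ _ cs cvg_snd).
  have zbarE : adj G zbar = c - adj F ys.
    apply: (cvg_unique _ _ (cvg_along sP Gz_cvg)) => //=.
    exact: (linear_cvg (adj G : {linear Z -> X}) z_cvg).
  by rewrite ybarE; exact: KKT_primal_solution (kkt zbar zbarE).
- split => //; rewrite (KKT_optimal_value p_proper f_convex f_differentiable kkts).
  have [_ /eqP + _] := kkts; rewrite subr_eq0 => /eqP Gxs.
  rewrite /objective -(fineK (KKT_fin p_proper kkts)) -EFinD -cvg_shiftS.
  under eq_fun do rewrite -(fineK (p_fin _)) -EFinD.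
  apply: cvg_EFin; first by near=> k.
  rewrite (cvg_shiftS (fun k => fine (p (y k ord0)) + (f (y k) - dot b (z k)))).
  apply: cvgD => //; apply: cvgB.
    apply: (cvg_comp _ _ y_cvg); exact: differentiable_continuous.
  rewrite -Gxs -(adjEr G); under eq_fun do rewrite -(adjEr G).
  by rewrite zsE; apply: dot_cvg => //; exact: cvg_cst.
(* [z k] differs from its projection by an element of the kernel of [adj G], so
   replacing the projection by its limit gives a KKT point for every [k]. *)
- pose z' k := z k - metric_proj (range G) (z k) + zs.
  pose d k := Num.sqrt (`|x k - xs| ^+ 2 + `|y k - ys| ^+ 2
    + `|metric_proj (range G) (z k) - zs| ^+ 2).
  have kkt' k : KKT_set p f F G b c (xs, ys, z' k).
    apply: kkt; rewrite /z' adjD adjB projE GK' subrr add0r.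
    exact: zsE.
  have d_cvg : d @ \oo --> (0 : R).
    rewrite -[X in _ --> X]sqrtr0 -[X in _ --> Num.sqrt X](addr0 0).
    rewrite -[X in _ --> Num.sqrt (X + _)](addr0 0).
    apply: continuous_cvg; first exact: sqrt_continuous.
    by apply: cvgD; [apply: cvgD|]; exact: cvg_sqr_norm_sub.
  apply: (squeeze_cvgr _ (cvg_cst _) d_cvg); near=> k.
  have lb : lbound [set pdist (x k, y k, z k) w | w in KKT_set p f F G b c] 0.
    by move=> _ [w _ <-]; exact: sqrtr_ge0.
  apply/andP; split.
    by apply: lb_le_inf => //; eexists; exists (xs, ys, z' k).
  apply: ge_inf; first by exists 0.
  exists (xs, ys, z' k) => //; rewrite /pdist /d /=.
  by rewrite /z' opprD opprB addrA subrKC.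
- move=> G_surj.
  have range_all v : metric_proj (range G) v = v.
    rewrite projE; apply/eqP; rewrite -subr_eq0; apply/eqP/dot_eq0.
    have [u uE] := G_surj (K' (adj G v) - v).
    by rewrite -{2}uE -(adjE G) adjB GK' subrr dot0l.
  exists xs, ys, zs; split => //.
  have z_cvg : z @ \oo --> zs by move: proj_cvg; under eq_fun do rewrite range_all.
  exact: (cvg_pair (cvg_pair x_cvg y_cvg) z_cvg).
Unshelve. all: by end_near. Qed.
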